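(* Consider the grid point $(x_i,y_j)=(\xi,\zeta)$. Assume that $u_p$ and $f_p$ have uniformly continuous partial derivatives of (total) orders up to seven and five, respectively, in $\Omega_p$ for $p=1,2,3,4$, and that the one-dimensional functions $\phi_p$ and $\psi_p$ on $\Gamma_p$ have uniformly continuous derivatives of orders up to seven and six, respectively, for $p=1,2,3,4$. Let $(x_i^*,y_j^* ):=(\xi,\zeta)$ and let $\mathcal{L}_h$ be the discrete operator with stencil coefficients $$C_{-1,1}=\frac{-a_1^2(a_2+a_3)}{a_2^2(a_1+a_4)},\quad C_{0,1}=\frac{-2(a_1+a_2)}{a_2},\quad C_{1,1}=-1,$$ $$C_{-1,0}=\frac{-2a_1(a_2+a_3)}{a_2^2},\quad C_{0,0}=\frac{5(a_2+a_3)(a_1+a_2)}{a_2^2},\quad C_{1,0}=\frac{-2(a_2+a_3)}{a_2},$$ $$C_{-1,-1}=\frac{-a_1a_4(a_2+a_3)}{a_2^2(a_1+a_4)},\quad C_{0,-1}=\frac{-2a_3(a_1+a_2)}{a_2^2},\quad C_{1,-1}=\frac{-a_3}{a_2}.$$ Then the compact 9-point finite difference scheme $h^{-1}\mathcal{L}_hu_h=h^{-1}F$ has a seventh order of consistency at the grid point $(x_i,y_j)=(\xi,\zeta)$, i.e. $h^{-1}(\mathcal{L}_hu-F)=O(h^7)$ as $h\to0$, where $$F:=\sum_{(n,m)\in\Lambda_7^1}F^{1}_{m,n}+\sum_{(m,n)\in\Lambda_5}F_{m,n}+\sum_{(n,m)\in\Lambda_7^1}\Phi^1_{m,n}+\sum_{m=0}^7\Phi_m+\sum_{(n,m)\in\Lambda_7^1}\Psi^1_{m,n}+\sum_{m=0}^6\Psi_m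 .$$
   Context: **Problem.** Let $l_1<l_2$, $l_3<l_4$ be real with $l_4-l_3=N_0(l_2-l_1)$ for a positive integer $N_0$, let $\Omega=(l_1,l_2)\times(l_3,l_4)$ and $(\xi,\zeta)\in\Omega$. Put $\Gamma_1=\{\xi\}\times(\zeta,l_4)$, $\Gamma_2=\{\xi\}\times(l_3,\zeta)$, $\Gamma_3=(\xi,l_2)\times\{\zeta\}$, $\Gamma_4=(l_1,\xi)\times\{\zeta\}$, $\Gamma=\Gamma_1\cup\Gamma_2\cup\Gamma_3\cup\Gamma_4\cup\{(\xi,\zeta)\}$, and $\Omega_1=(l_1,\xi)\times(\zeta,l_4)$, $\Omega_2=(\xi,l_2)\times(\zeta,l_4)$, $\Omega_3=(\xi,l_2)\times(l_3,\zeta)$, $\Omega_4=(l_1,\xi)\times(l_3,\zeta)$. The coefficient $a$ equals a positive constant $a_p$ on $\Omega_p$; $u_p$ and $f_p$ denote the restrictions of $u$ and $f$ to $\Omega_p$ (with their derivatives extended continuously to $\overline{\Omega_p}$). The function $u$ is the exact solution of the elliptic cross-interface problem $$-\nabla\cdot(a\nabla u)=f\ \text{in }\Omega\setminus\Gamma,\quad [u]=\phi_p,\ [a\nabla u\cdot\vec n]=\psi_p\ \text{on }\Gamma_p\ (p=1,2,3,4),\quad u=g\ \text{on }\partial\Omega .$$ On $\Gamma_1,\Gamma_2$ the bracket is the limit $x\to\xi^+$ minus the limit $x\to\xi^-$ and $a\nabla u\cdot\vec n=a\,\partial u/\partial x$; on $\Gamma_3,\Gamma_4$ it is the limit $y\to\zeta^+$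 minus the limit $y\to\zeta^-$ and $a\nabla u\cdot\vec n=a\,\partial u/\partial y$. **Mesh.** $x_i=l_1+ih$ ($0\le i\le N_1$), $y_j=l_3+jh$ ($0\le j\le N_2$), $h=(l_2-l_1)/N_1$, $N_2=N_0N_1$. For real stencil coefficients $C_{k,\ell}$, $\mathcal{L}_hu_h:=\sum_{k,\ell=-1}^1C_{k,\ell}(u_h)_{i+k,j+\ell}$ for a grid function $u_h$, and $\mathcal{L}_hu:=\sum_{k,\ell=-1}^1C_{k,\ell}\,u(x_i+kh,y_j+\ell h)$ for the exact solution, where at $(\xi,\zeta)$ the values are (continuous extensions): $u_1$ for $(k,\ell)\in\{(-1,0),(-1,1)\}$; $u_2$ for $k,\ell\in\{0,1\}$; $u_3$ for $(k,\ell)\in\{(0,-1),(1,-1)\}$; $u_4$ for $(k,\ell)=(-1,-1)$. The scheme $h^{-1}\mathcal{L}_hu_h=h^{-1}F$ has order of consistency $r$ if $h^{-1}(\mathcal{L}_hu-F)=O(h^r)$ as $h\to0$ (constant independent of $h$), over meshes having $(\xi,\zeta)$ as a grid point. **Notation.** $f_p^{(m,n)}=\frac{\partial^{m+n}f_p}{\partial x^m\partial y^n}(\xi,\zeta)$. For $p=1,2$, $\phi_p^{(n)},\psi_p^{(n)}$ are the $n$-th $y$-derivatives of $\phi_p(\xi,y),\psi_p(\xi,y)$ and for $p=3,4$ the $n$-th $x$-derivatives of $\phi_p(x,\zeta),\psi_p(x,\zeta)$, evaluated (as one-sided limits along $\Gamma_p$) at $(\xi,\zeta)$. $\Lambda_M=\{(m,n)\in\mathbb{Z}_{\ge0}^2: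 m+n\le M\}$, $\Lambda^1_M=\{(m,n)\in\Lambda_M: m\in\{0,1\}\}$; thus a sum over $(n,m)\in\Lambda_M^1$ means $n\in\{0,1\}$, $m\ge0$, $m+n\le M$. $\mathrm{odd}(m)=0$ for $m$ even and $1$ for $m$ odd; terms multiplied by $\mathrm{odd}(\cdot)=0$ are zero, and empty sums are zero. Define $$G_{m,n}(x,y)=\sum_{\ell=0}^{\lfloor n/2\rfloor}\frac{(-1)^\ell x^{m+2\ell}y^{n-2\ell}}{(m+2\ell)!(n-2\ell)!},\qquad H_{m,n}(x,y)=\sum_{\ell=1}^{1+\lfloor n/2\rfloor}\frac{(-1)^\ell x^{m+2\ell}y^{n-2\ell+2}}{(m+2\ell)!(n-2\ell+2)!},$$ $$G^1_{m,n}=\sum_{\ell=0}^1C_{-1,\ell}G_{m,n}(-h,\ell h),\quad G^3_{m,n}=\sum_{k=0}^1C_{k,-1}G_{n,m}(-h,kh),\quad G^4_{m,n}=C_{-1,-1}G_{n,m}(-h,-h),$$ $$H^1_{m,n}=\sum_{\ell=0}^1C_{-1,\ell}H_{m,n}(-h,\ell h),\quad H^2_{m,n}=\sum_{k=0}^1\sum_{\ell=0}^1C_{k,\ell}H_{m,n}(kh,\ell h),$$ $$H^3_{m,n}=\sum_{k=0}^1C_{k,-1}H_{n,m}(-h,kh),\quad H^4_{m,n}=C_{-1,-1}H_{n,m}(-h,-h),$$ $$F^1_{m,n}=\frac1{a_2}\Big(\frac{a_2}{a_3}\Big)^n\sum_{s=1}^{\lfloor m/2\rfloor}(-1)^sf_2^{(m-2s,n+2s-2)}G^3_{m,n}+\frac1{a_1}\Big(\frac{a_1}{a_4}\Big)^n\sum_{s=1}^{\lfloor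 m/2\rfloor}(-1)^sf_1^{(m-2s,n+2s-2)}G^4_{m,n},\qquad F_{m,n}=\sum_{p=1}^4\frac{f_p^{(m,n)}}{a_p}H^p_{m,n},$$ $$\Phi^1_{m,n}=-(-1)^{\lfloor m/2\rfloor}\mathrm{odd}(m+1)\,\phi_1^{(m+n)}\Big(\frac{a_1}{a_4}\Big)^nG^4_{m,n},\qquad \Phi_m=-\phi_1^{(m)}G^1_{0,m}-\sum_{p=3}^4\phi_p^{(m)}G^p_{m,0},$$ $$\Psi^1_{m,n}=-(-1)^{\lfloor m/2\rfloor}\frac{\mathrm{odd}(m)}{a_1}\psi_1^{(m+n-1)}\Big(\frac{a_1}{a_4}\Big)^nG^4_{m,n},\qquad \Psi_m=-\frac{\psi_1^{(m)}}{a_1}G^1_{1,m}-\sum_{p=3}^4\frac{\psi_p^{(m)}}{a_p}G^p_{m,1}.$$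
   Formalization: The formal theorem additionally assumes that the seventh-order partial derivatives of each u_p are Lipschitz on Ω_p; with mere uniform continuity the claim fails, e.g. a_p=1, zero jumps, u=|x−ξ|^{15/2} gives h^{-1}(L_h u−F)=−12h^{13/2}. *)

(* Defs.v *)
From Stdlib Require Export Reals ZArith List.
From Coquelicot Require Export Coquelicot.
Export ListNotations.
Open Scope R_scope.

Definition Rsum {I : Type} (s : list I) (F : I -> R) : R :=
  fold_right Rplus 0 (map F s).

(* Indexes both the quadrants [Omega_p] and the branches [Gamma_p]. *)
Inductive idx : Set := p1 | p2 | p3 | p4.

(* [phi p] and [psi p] are functions of the coordinate running along [Gamma_p]:
   y for p = 1, 2 and x for p = 3, 4.  Values of [coef], [f] and of a solution
   off the sets where the problem prescribes them are irrelevant. *)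
Record cross_problem := CrossProblem {
  l1 : R; l2 : R; l3 : R; l4 : R;
  N0 : nat;
  xi : R; zeta : R;
  a : idx -> R;
  coef : R -> R -> R;
  f : R -> R -> R;
  g : R -> R -> R;
  phi : idx -> R -> R;
  psi : idx -> R -> R
}.

Definition Omega (P : cross_problem) (x y : R) : Prop :=
  l1 P < x < l2 P /\ l3 P < y < l4 P.

Definition bdOmega (P : cross_problem) (x y : R) : Prop :=
  l1 P <= x <= l2 P /\ l3 P <= y <= l4 P /\
  (x = l1 P \/ x = l2 P \/ y = l3 P \/ y = l4 P).

Definition Omegap (P : cross_problem) (p : idx) (x y : R) : Prop :=
  match p with
  | p1 => l1 P < x < xi P /\ zeta P < y < l4 P
  | p2 => xi P < x < l2 P /\ zeta P < y < l4 P
  | p3 => xi P < x < l2 P /\ l3 P < y < zeta P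
  | p4 => l1 P < x < xi P /\ l3 P < y < zeta P
  end.

(* The open interval swept by the running coordinate of [Gamma_p]. *)
Definition branch (P : cross_problem) (p : idx) (t : R) : Prop :=
  match p with
  | p1 => zeta P < t < l4 P
  | p2 => l3 P < t < zeta P
  | p3 => xi P < t < l2 P
  | p4 => l1 P < t < xi P
  end.

Definition Gammap (P : cross_problem) (p : idx) (x y : R) : Prop :=
  match p with
  | p1 | p2 => x = xi P /\ branch P p y
  | p3 | p4 => branch P p x /\ y = zeta P
  end.

Definition Gamma (P : cross_problem) (x y : R) : Prop :=
  (exists p, Gammap P p x y) \/ (x = xi P /\ y = zeta P).

Definition uc_on (A : R -> R -> Prop) (v : R -> R -> R) : Prop :=
  forall eps : posreal, exists delta : posreal,
    forall x y x' y', A x y -> A x' y' ->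
      Rabs (x - x') < delta -> Rabs (y - y') < delta ->
      Rabs (v x y - v x' y') < eps.

(* Required of the order-seven partials of u: when these are merely uniformly
   continuous, the Taylor remainder at (xi, zeta) is o(h^7) but in general not
   O(h^8).  For instance with a = 1, zero jumps and u(x, y) = |x - xi|^(15/2),
   the right-hand side F vanishes and L_h u = -12 h^(15/2). *)
Definition lipschitz_on (A : R -> R -> Prop) (v : R -> R -> R) : Prop :=
  exists K, forall x y x' y', A x y -> A x' y' ->
    Rabs (v x y - v x' y') <= K * (Rabs (x - x') + Rabs (y - y')).

Definition uc_partials (A : R -> R -> Prop) (v : R -> R -> R) (k : nat) : Prop :=
  (forall x y, A x y -> ex_diff_n v k x y) /\
  (forall m n, (m + n <= k)%nat -> uc_on A (partial_derive m n v)).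

Definition uc_derivs (A : R -> Prop) (v : R -> R) (k : nat) : Prop :=
  forall n, (n <= k)%nat ->
    (forall t, A t -> ex_derive_n v n t) /\ uniform_continuity (Derive_n v n) A.

(* Total limit operators: meaningful only when the limit exists, which the
   uniform continuity hypotheses of the theorem guarantee. *)
Definition extension (A : R -> R -> Prop) (v : R -> R -> R) (x y : R) : R :=
  @lim R_CompleteSpace
    (filtermap (fun z : R * R => v (fst z) (snd z))
       (within (fun z : R * R => A (fst z) (snd z)) (locally (x, y)))).

Definition end_value (P : cross_problem) (p : idx) (v : R -> R) : R :=
  @lim R_CompleteSpace
    (filtermap v
       match p with
       | p1 => at_right (zeta P)
       | p2 => at_left (zeta P)
       | p3 => at_right (xi P)
       | p4 => at_left (xi P)
       end).

Definition dx (v : R -> R -> R) (x y : R) : R := Derive (fun s => v s y) x.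
Definition dy (v : R -> R -> R) (x y : R) : R := Derive (fun t => v x t) y.

(* The limit of [v] at [c] from the right minus that from the left is [d]. *)
Definition jump (v : R -> R) (c d : R) : Prop :=
  exists r l : R, filterlim v (at_right c) (locally r) /\
    filterlim v (at_left c) (locally l) /\ r - l = d.

(* The condition u = g on the boundary is imposed on the trace of u from
   Omega \ Gamma; the four end points of Gamma are left out since u may have two
   different one-sided limits there. *)
Definition exact_solution (P : cross_problem) (u : R -> R -> R) : Prop :=
  (forall x y, Omega P x y -> ~ Gamma P x y ->
     - (dx (fun s t => coef P s t * dx u s t) x y
        + dy (fun s t => coef P s t * dy u s t) x y) = f P x y) /\
  (forall p x y, Gammap P p x y ->
     match p with
     | p1 | p2 =>
         jump (fun s => u s y) (xi P) (phi P p y) /\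
         jump (fun s => coef P s y * dx u s y) (xi P) (psi P p y)
     | p3 | p4 =>
         jump (fun t => u x t) (zeta P) (phi P p x) /\
         jump (fun t => coef P x t * dy u x t) (zeta P) (psi P p x)
     end) /\
  (forall x y, bdOmega P x y -> x <> xi P -> y <> zeta P ->
     filterlim (fun z : R * R => u (fst z) (snd z))
       (within (fun z : R * R => Omega P (fst z) (snd z) /\
                                 ~ Gamma P (fst z) (snd z)) (locally (x, y)))
       (locally (g P x y))).

(* [w k l] is the value at the node (x_i + k h, y_j + l h). *)
Definition Lh (C w : Z -> Z -> R) : R :=
  Rsum [-1; 0; 1]%Z (fun k => Rsum [-1; 0; 1]%Z (fun l => C k l * w k l)).

Definition node_piece (k l : Z) : idx :=
  if (0 <=? l)%Z
  then if (0 <=? k)%Z then p2 else p1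
  else if (0 <=? k)%Z then p3 else p4.

Definition node_value (P : cross_problem) (u : R -> R -> R) (h : R) (k l : Z) : R :=
  extension (Omegap P (node_piece k l)) u (xi P + IZR k * h) (zeta P + IZR l * h).

Definition cross_mesh (P : cross_problem) (h : R) : Prop :=
  exists N1 N2 i j : nat,
    (0 < N1)%nat /\ N2 = (N0 P * N1)%nat /\ h = (l2 P - l1 P) / INR N1 /\
    (i <= N1)%nat /\ (j <= N2)%nat /\
    xi P = l1 P + INR i * h /\ zeta P = l3 P + INR j * h.

(* Consistency at (xi, zeta) of the scheme h^-1 L_h u_h = h^-1 F. *)
Definition consistency_order (P : cross_problem) (u : R -> R -> R)
    (C : Z -> Z -> R) (F : R -> R) (r : nat) : Prop :=
  exists K h0 : R, 0 < h0 /\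
    forall h, cross_mesh P h -> h < h0 ->
      Rabs (/ h * (Lh C (node_value P u h) - F h)) <= K * h ^ r.

Definition stencil (P : cross_problem) (k l : Z) : R :=
  let a1 := a P p1 in let a2 := a P p2 in
  let a3 := a P p3 in let a4 := a P p4 in
  match k, l with
  | (-1)%Z, 1%Z => - a1 ^ 2 * (a2 + a3) / (a2 ^ 2 * (a1 + a4))
  | 0%Z, 1%Z => -2 * (a1 + a2) / a2
  | 1%Z, 1%Z => -1
  | (-1)%Z, 0%Z => -2 * a1 * (a2 + a3) / a2 ^ 2
  | 0%Z, 0%Z => 5 * (a2 + a3) * (a1 + a2) / a2 ^ 2
  | 1%Z, 0%Z => -2 * (a2 + a3) / a2
  | (-1)%Z, (-1)%Z => - a1 * a4 * (a2 + a3) / (a2 ^ 2 * (a1 + a4))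
  | 0%Z, (-1)%Z => -2 * a3 * (a1 + a2) / a2 ^ 2
  | 1%Z, (-1)%Z => - a3 / a2
  | _, _ => 0
  end.

Definition Lambda (M : nat) : list (nat * nat) :=
  filter (fun q => fst q + snd q <=? M)%nat
    (list_prod (seq 0 (S M)) (seq 0 (S M))).

Definition Lambda1 (M : nat) : list (nat * nat) :=
  filter (fun q => fst q <=? 1)%nat (Lambda M).

Definition odd (m : nat) : R := if Nat.odd m then 1 else 0.

Definition fD (P : cross_problem) (p : idx) (m n : nat) : R :=
  extension (Omegap P p) (partial_derive m n (f P)) (xi P) (zeta P).
Definition phiD (P : cross_problem) (p : idx) (n : nat) : R :=
  end_value P p (Derive_n (phi P p) n).
Definition psiD (P : cross_problem) (p : idx) (n : nat) : R :=
  end_value P p (Derive_n (psi P p) n).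

(* The truncated subtractions in the formulas below are all genuine, except for
   m + n - 1 in [Psi1] at m = n = 0, where the factor [odd m] vanishes. *)
Definition G (m n : nat) (x y : R) : R :=
  Rsum (seq 0 (n / 2 + 1)) (fun l =>
    (-1) ^ l * x ^ (m + 2 * l) * y ^ (n - 2 * l)
    / (INR (fact (m + 2 * l)) * INR (fact (n - 2 * l)))).

Definition H (m n : nat) (x y : R) : R :=
  Rsum (seq 1 (1 + n / 2)) (fun l =>
    (-1) ^ l * x ^ (m + 2 * l) * y ^ (n + 2 - 2 * l)
    / (INR (fact (m + 2 * l)) * INR (fact (n + 2 - 2 * l)))).

Definition G1 (C : Z -> Z -> R) (h : R) (m n : nat) : R :=
  Rsum [0; 1]%Z (fun l => C (-1)%Z l * G m n (- h) (IZR l * h)).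
Definition G3 (C : Z -> Z -> R) (h : R) (m n : nat) : R :=
  Rsum [0; 1]%Z (fun k => C k (-1)%Z * G n m (- h) (IZR k * h)).
Definition G4 (C : Z -> Z -> R) (h : R) (m n : nat) : R :=
  C (-1)%Z (-1)%Z * G n m (- h) (- h).

Definition Hp (C : Z -> Z -> R) (h : R) (p : idx) (m n : nat) : R :=
  match p with
  | p1 => Rsum [0; 1]%Z (fun l => C (-1)%Z l * H m n (- h) (IZR l * h))
  | p2 => Rsum [0; 1]%Z (fun k => Rsum [0; 1]%Z (fun l =>
            C k l * H m n (IZR k * h) (IZR l * h)))
  | p3 => Rsum [0; 1]%Z (fun k => C k (-1)%Z * H n m (- h) (IZR k * h))
  | p4 => C (-1)%Z (-1)%Z * H n m (- h) (- h)
  end.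

Definition F1 (P : cross_problem) (C : Z -> Z -> R) (h : R) (m n : nat) : R :=
  / a P p2 * (a P p2 / a P p3) ^ n *
    Rsum (seq 1 (m / 2)) (fun s =>
      (-1) ^ s * fD P p2 (m - 2 * s) (n + 2 * s - 2) * G3 C h m n)
  + / a P p1 * (a P p1 / a P p4) ^ n *
    Rsum (seq 1 (m / 2)) (fun s =>
      (-1) ^ s * fD P p1 (m - 2 * s) (n + 2 * s - 2) * G4 C h m n).

Definition F0 (P : cross_problem) (C : Z -> Z -> R) (h : R) (m n : nat) : R :=
  Rsum [p1; p2; p3; p4] (fun p => fD P p m n / a P p * Hp C h p m n).

Definition Phi1 (P : cross_problem) (C : Z -> Z -> R) (h : R) (m n : nat) : R :=
  - ((-1) ^ (m / 2) * odd (m + 1) * phiD P p1 (m + n)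
     * (a P p1 / a P p4) ^ n * G4 C h m n).

Definition Phi (P : cross_problem) (C : Z -> Z -> R) (h : R) (m : nat) : R :=
  - (phiD P p1 m * G1 C h 0 m)
  - (phiD P p3 m * G3 C h m 0 + phiD P p4 m * G4 C h m 0).

Definition Psi1 (P : cross_problem) (C : Z -> Z -> R) (h : R) (m n : nat) : R :=
  - ((-1) ^ (m / 2) * (odd m / a P p1) * psiD P p1 (m + n - 1)
     * (a P p1 / a P p4) ^ n * G4 C h m n).

Definition Psi (P : cross_problem) (C : Z -> Z -> R) (h : R) (m : nat) : R :=
  - (psiD P p1 m / a P p1 * G1 C h 1 m)
  - (psiD P p3 m / a P p3 * G3 C h m 1 + psiD P p4 m / a P p4 * G4 C h m 1).

(* [Lambda1] consists of pairs (n, m), the restricted index coming first. *)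
Definition rhs (P : cross_problem) (C : Z -> Z -> R) (h : R) : R :=
  Rsum (Lambda1 7) (fun '(n, m) => F1 P C h m n)
  + Rsum (Lambda 5) (fun '(m, n) => F0 P C h m n)
  + Rsum (Lambda1 7) (fun '(n, m) => Phi1 P C h m n)
  + Rsum (seq 0 8) (fun m => Phi P C h m)
  + Rsum (Lambda1 7) (fun '(n, m) => Psi1 P C h m n)
  + Rsum (seq 0 7) (fun m => Psi P C h m).

(* Main.v *)
Require Import Defs.
From Stdlib Require Import Lra Lia.

(* On each quadrant, Taylor's formula at (xi, zeta) with Lipschitz partials of order seven
   has a remainder O(h^8), so up to O(h^8) every node value is a polynomial in h whose
   coefficients are the corner limits of the partials of u.  These limits are linked by the
   differentiated equation, which reduces one order of differentiation to {0, 1}, and by the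
   interface conditions: comparing the Taylor expansion of phi_p or psi_p at the corner with
   that of the jump of traces identifies coefficients, so the limit along an interface never
   has to be differentiated.  Eliminating u_1, u_3 and u_4 produces F and leaves a combination
   of the limits of u_2 of order at most one in x, whose coefficients vanish for this stencil. *)

(** * Taylor expansions in one variable *)

(** The four quadrants cannot all be reduced in the same way. A vertical interface links limits of
    x-order at most one and any y-order; a horizontal one links limits of y-order at most one and
    any x-order. The reduction to orders {0, 1} therefore acts on x in quadrants 1 and 2 and on y in
    quadrants 3 and 4. Crossing the horizontal interfaces then turns u_3 and u_4 into limits of u_2
    and u_1 with the wrong order bounded, so the equation is used there a second time. This second
    use produces [F1]; carrying the u_4 terms on across [Gamma_1] produces [Phi1] and [Psi1]. What
    finally multiplies the limit of u_2 of order (m, n) is a multiple of h^(m+n), so the nine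
    stencil entries have to satisfy fifteen linear conditions. For equal a_p the stencil is the
    classical one with weights 20, -4, -1, which annihilates the harmonic polynomials of degree at
    most seven but not the real part of (x + i y)^8. *)

Definition mono (x : R) (n : nat) : R := x ^ n / INR (fact n).

Definition taylor_poly (c : nat -> R) (k : nat) (t : R) : R :=
  sum_f_R0 (fun n => c n * mono t n) k.

Lemma mono_opp (x : R) (n : nat) : mono (- x) n = (-1) ^ n * mono x n.
Proof.
  unfold mono. replace (- x) with (-1 * x) by ring. rewrite Rpow_mult_distr.
  unfold Rdiv. ring.
Qed.

Lemma taylor_poly_0 (c : nat -> R) (k : nat) : taylor_poly c k 0 = c 0%nat.
Proof.
  unfold taylor_poly. induction k as [|k IH]; simpl.
  - unfold mono; simpl; field.
  - rewrite IH. unfold mono. simpl pow. unfold Rdiv. ring.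
Qed.

Lemma Rabs_mono_le (t : R) (n : nat) : Rabs (mono t n) <= Rabs t ^ n.
Proof.
  unfold mono. rewrite Rabs_div by apply INR_fact_neq_0.
  rewrite <- RPow_abs, (Rabs_pos_eq (INR (fact n))) by apply pos_INR.
  assert (Hf : 1 <= INR (fact n)).
  { change 1 with (INR 1). apply le_INR. pose proof (lt_O_fact n). lia. }
  apply Rle_div_l; [lra|].
  pose proof (pow_le (Rabs t) n (Rabs_pos t)). nra.
Qed.

(** The Lagrange term is split into its value at x and a difference of k-th derivatives, so the
    error is governed by the modulus of continuity of the k-th derivative. *)
Lemma taylor_right (g : R -> R) (k : nat) (x y : R) :
  x < y ->
  (forall t, x <= t <= y -> forall j, (j <= k)%nat -> ex_derive_n g j t) ->
  exists z, x <= z <= y /\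
    g y = taylor_poly (fun j => Derive_n g j x) k (y - x)
          + (Derive_n g k z - Derive_n g k x) * mono (y - x) k.
Proof.
  intros Hxy Hg. destruct k as [|k].
  (* At order zero the remainder is the increment of g itself, so the point is y. *)
  - exists y. split; [lra|]. unfold taylor_poly, mono. simpl. field.
  - destruct (Taylor_Lagrange g k x y Hxy Hg) as [z [Hz Heq]].
    exists z. split; [lra|]. rewrite Heq. unfold taylor_poly. rewrite tech5.
    rewrite (sum_eq (fun n => Derive_n g n x * mono (y - x) n)
      (fun m => (y - x) ^ m / INR (fact m) * Derive_n g m x))
      by (intros; unfold mono; ring).
    unfold mono, Rdiv. ring.
Qed.

Lemma taylor_interval (g : R -> R) (k : nat) (a b x y : R) :
  (forall t, a < t < b -> forall j, (j <= k)%nat -> ex_derive_n g j t) ->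
  a < x < b -> a < y < b ->
  exists z, a < z < b /\ Rabs (z - x) <= Rabs (y - x) /\
    g y = taylor_poly (fun j => Derive_n g j x) k (y - x)
          + (Derive_n g k z - Derive_n g k x) * mono (y - x) k.
Proof.
  intros Hg Hx Hy. destruct (Rtotal_order x y) as [H | [H | H]].
  - destruct (taylor_right g k x y H) as [z [Hz Heq]].
    { intros; apply Hg; auto; lra. }
    exists z. split; [lra|]. split; [|exact Heq]. rewrite !Rabs_pos_eq; lra.
  - subst y. exists x. split; [lra|]. split; [lra|].
    replace (x - x) with 0 by ring. rewrite taylor_poly_0. simpl. ring.
  (* A point y to the left of x is reached by reflection: each sign (-1)^j comes once from the
     derivative and once from the monomial, and squares to 1. *)
  - assert (Hn : forall j t, (j <= k)%nat -> a < - t < b ->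
      Derive_n (fun s => g (- s)) j t = (-1) ^ j * Derive_n g j (- t)).
    { intros j t Hj Ht. apply Derive_n_comp_opp.
      apply (locally_interval _ (- t) a b); try (simpl; lra).
      intros s Hs1 Hs2 i Hi. simpl in *. apply Hg; [lra|lia]. }
    destruct (taylor_right (fun s => g (- s)) k (- x) (- y)) as [z [Hz Heq]]; [lra| |].
    { intros t Ht j Hj. apply ex_derive_n_comp_opp.
      apply (locally_interval _ (- t) a b); try (simpl; lra).
      intros s Hs1 Hs2 i Hi. simpl in *. apply Hg; [lra|lia]. }
    exists (- z). split; [lra|]. split.
    { rewrite !Rabs_left1; lra. }
    rewrite Ropp_involutive in Heq. rewrite Heq.
    replace (- y - - x) with (- (y - x)) by ring.
    assert (Hp : forall n, (-1) ^ n * (-1) ^ n = 1).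
    { intro n. rewrite <- Rpow_mult_distr. replace (-1 * -1) with 1 by ring. apply pow1. }
    rewrite !Hn, Ropp_involutive by (try lia; lra). rewrite mono_opp. f_equal.
    + unfold taylor_poly. apply sum_eq. intros i Hi.
      rewrite Hn, Ropp_involutive by (try lia; lra). rewrite mono_opp.
      transitivity ((-1) ^ i * (-1) ^ i * (Derive_n g i x * mono (y - x) i)); [ring|].
      rewrite Hp. ring.
    + transitivity ((-1) ^ k * (-1) ^ k *
        ((Derive_n g k (- z) - Derive_n g k x) * mono (y - x) k)); [ring|].
      rewrite Hp. ring.
Qed.

(** Letting t tend to 0 kills the constant term; dividing by t then gives the same hypothesis one
    degree lower. *)
Lemma poly_small_coeffs (N : nat) (c : nat -> R) :
  (forall eps, 0 < eps -> exists delta, 0 < delta /\ forall t, 0 < t < delta ->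
     Rabs (sum_f_R0 (fun n => c n * t ^ n) N) <= eps * t ^ N) ->
  forall n, (n <= N)%nat -> c n = 0.
Proof.
  revert c. induction N as [|N IH]; intros c Hc n Hn.
  - replace n with 0%nat by lia. apply Rabs_eq_0.
    apply Rle_antisym; [|apply Rabs_pos]. apply le_epsilon. intros eps He.
    destruct (Hc eps He) as [d [Hd H]]. specialize (H (d / 2) ltac:(lra)).
    simpl in H. rewrite !Rmult_1_r in H. lra.
  - assert (H0 : c 0%nat = 0).
    { assert (Hl : is_lim_seq (fun i => sum_f_R0 (fun n => c n * (/ (INR i + 1)) ^ n) (S N)) (c 0%nat)).
      { replace (Finite (c 0%nat)) with (Finite (sum_f_R0 (fun n => c n * 0 ^ n) (S N))).
        2: { f_equal. clear. induction N; simpl in *; [ring|]. rewrite IHN. ring. }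
        apply (is_lim_seq_continuous (fun t => sum_f_R0 (fun n => c n * t ^ n) (S N))).
        - apply continuity_finite_sum.
        - replace (Finite 0) with (Rbar_inv p_infty) by reflexivity.
          apply is_lim_seq_inv; [|discriminate].
          eapply is_lim_seq_plus; [apply is_lim_seq_INR|apply is_lim_seq_const|reflexivity]. }
      destruct (Hc 1 Rlt_0_1) as [d [Hd H]].
      assert (Hl2 : is_lim_seq (fun i => 1 * (/ (INR i + 1)) ^ S N) 0).
      { replace 0 with (1 * 0 ^ S N) by (simpl; ring).
        apply (is_lim_seq_continuous (fun t => 1 * t ^ S N)).
        - apply derivable_continuous. reg.
        - replace (Finite 0) with (Rbar_inv p_infty) by reflexivity.
          apply is_lim_seq_inv; [|discriminate].
          eapply is_lim_seq_plus; [apply is_lim_seq_INR|apply is_lim_seq_const|reflexivity]. }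
      apply Rabs_eq_0. apply Rle_antisym; [|apply Rabs_pos].
      refine (is_lim_seq_le_loc _ _ _ _ _ (is_lim_seq_abs _ _ Hl) Hl2).
      (* The sample point 1/(i + 1) lies below d as soon as i reaches the integer part of 1/d. *)
      destruct (nfloor_ex (/ d)) as [m Hm]. { left; apply Rinv_0_lt_compat; lra. }
      exists m. intros i Hi. apply H. apply le_INR in Hi.
      assert (0 < / d) by (apply Rinv_0_lt_compat; lra).
      split; [apply Rinv_0_lt_compat; lra|].
      rewrite <- (Rinv_inv d). apply Rinv_lt_contravar; [|lra].
      apply Rmult_lt_0_compat; lra. }
    destruct n as [|n]; [exact H0|].
    apply (IH (fun n => c (S n))); [|lia].
    intros eps He. destruct (Hc eps He) as [d [Hd H]]. exists d. split; [exact Hd|].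
    intros t Ht. specialize (H t Ht). rewrite decomp_sum in H by lia.
    simpl Init.Nat.pred in H. rewrite H0, Rmult_0_l, Rplus_0_l in H.
    replace (sum_f_R0 (fun i => c (S i) * t ^ S i) N)
      with (t * sum_f_R0 (fun n => c (S n) * t ^ n) N) in H.
    2: { rewrite scal_sum. apply sum_eq. intros; simpl; ring. }
    rewrite Rabs_mult, (Rabs_pos_eq t) in H by lra. simpl in H.
    apply Rmult_le_reg_l with t; [lra|]. lra.
Qed.

(* One-sided at [z], in the direction [s] (of absolute value 1): [D] need not be defined at [z],
   and [c n] plays the role of its n-th derivative there. *)
Definition expands (D : R -> R) (z s : R) (N : nat) (c : nat -> R) : Prop :=
  forall eps, 0 < eps -> exists delta, 0 < delta /\ forall t, 0 < t < delta ->
    Rabs (D (z + s * t) - taylor_poly c N (s * t)) <= eps * t ^ N.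

(** The difference of the two polynomials is o(t^N), and its coefficients are the c n - d n scaled
    by the nonzero factors s^n / n!. *)
Lemma expands_unique (D : R -> R) (z s : R) (N : nat) (c d : nat -> R) :
  Rabs s = 1 -> expands D z s N c -> expands D z s N d ->
  forall n, (n <= N)%nat -> c n = d n.
Proof.
  intros Hs Hc Hd n Hn.
  assert (Hs0 : s <> 0) by (intros ->; rewrite Rabs_R0 in Hs; lra).
  cut ((c n - d n) * s ^ n / INR (fact n) = 0).
  { intro H. apply Rminus_diag_uniq. unfold Rdiv in H.
    apply Rmult_integral in H as [H | H].
    - apply Rmult_integral in H as [H | H]; [exact H|].
      exfalso; exact (pow_nonzero s n Hs0 H).
    - exfalso. exact (Rinv_neq_0_compat _ (INR_fact_neq_0 n) H). }
  apply (poly_small_coeffs N (fun n => (c n - d n) * s ^ n / INR (fact n))); [|exact Hn].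
  intros eps He.
  destruct (Hc (eps / 2)) as [d1 [Hd1 H1]]; [lra|].
  destruct (Hd (eps / 2)) as [d2 [Hd2 H2]]; [lra|].
  exists (Rmin d1 d2). split; [apply Rmin_pos; lra|]. intros t Ht.
  pose proof (Rmin_l d1 d2). pose proof (Rmin_r d1 d2).
  specialize (H1 t ltac:(lra)). specialize (H2 t ltac:(lra)).
  replace (sum_f_R0 _ N) with (taylor_poly c N (s * t) - taylor_poly d N (s * t)).
  2: { unfold taylor_poly. rewrite <- minus_sum. apply sum_eq. intros i Hi. unfold mono.
       rewrite Rpow_mult_distr. unfold Rdiv. ring. }
  replace (taylor_poly c N (s * t) - taylor_poly d N (s * t)) with
    ((D (z + s * t) - taylor_poly d N (s * t)) - (D (z + s * t) - taylor_poly c N (s * t))) by ring.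
  eapply Rle_trans; [apply Rabs_triang|]. rewrite Rabs_Ropp. lra.
Qed.

Lemma taylor_poly_lin (c d : nat -> R) (al be : R) (k : nat) (t : R) :
  taylor_poly (fun n => al * c n - be * d n) k t
  = al * taylor_poly c k t - be * taylor_poly d k t.
Proof.
  unfold taylor_poly. rewrite !scal_sum, <- minus_sum. apply sum_eq. intros; ring.
Qed.

Lemma expands_lin (D E : R -> R) (z s al be : R) (N : nat) (c d : nat -> R) :
  expands D z s N c -> expands E z s N d ->
  expands (fun x => al * D x - be * E x) z s N (fun n => al * c n - be * d n).
Proof.
  intros Hc Hd eps He.
  pose proof (Rabs_pos al). pose proof (Rabs_pos be).
  (* The summand 1 keeps M positive when al = be = 0. *)
  set (M := 1 + Rabs al + Rabs be). assert (HM : 0 < M) by (unfold M; lra).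
  assert (He' : 0 < eps / M) by (apply Rdiv_lt_0_compat; lra).
  destruct (Hc _ He') as [d1 [Hd1 H1]]. destruct (Hd _ He') as [d2 [Hd2 H2]].
  exists (Rmin d1 d2). split; [apply Rmin_pos; lra|]. intros t Ht.
  pose proof (Rmin_l d1 d2). pose proof (Rmin_r d1 d2).
  specialize (H1 t ltac:(lra)). specialize (H2 t ltac:(lra)).
  rewrite taylor_poly_lin.
  replace (_ - _) with (al * (D (z + s * t) - taylor_poly c N (s * t))
    + - (be * (E (z + s * t) - taylor_poly d N (s * t)))) by ring.
  eapply Rle_trans; [apply Rabs_triang|]. rewrite Rabs_Ropp, !Rabs_mult.
  replace (eps * t ^ N) with (M * (eps / M * t ^ N)) by (field; lra).
  assert (0 <= eps / M * t ^ N).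
  { apply Rmult_le_pos; [lra|]. apply pow_le; lra. }
  unfold M at 1. nra.
Qed.

Lemma expands_ext (D E : R -> R) (z s : R) (N : nat) (c : nat -> R) (eta : R) :
  0 < eta -> (forall t, 0 < t < eta -> D (z + s * t) = E (z + s * t)) ->
  expands D z s N c -> expands E z s N c.
Proof.
  intros Heta HDE H eps He. destruct (H eps He) as [d [Hd H1]].
  exists (Rmin d eta). split; [apply Rmin_pos; lra|]. intros t Ht.
  pose proof (Rmin_l d eta). pose proof (Rmin_r d eta).
  rewrite <- HDE by lra. apply H1. lra.
Qed.

(** * Limits at the boundary of a rectangle and Taylor expansions in two variables *)

Definition rect (a b c d x y : R) : Prop := a < x < b /\ c < y < d.

(** Runs from the midpoint of the interval towards x and stays in the open interval even when x is
    an end point. Limits at the closed rectangle thus become limits along interior sequences. *)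
Definition approach (a b x : R) (n : nat) : R := x + ((a + b) / 2 - x) / (INR n + 1).

Lemma inv_INR_S_bounds (n : nat) : 0 < / (INR n + 1) <= 1.
Proof.
  pose proof (pos_INR n). split; [apply Rinv_0_lt_compat; lra|].
  rewrite <- Rinv_1. apply Rinv_le_contravar; lra.
Qed.

Lemma approach_in (a b x : R) (n : nat) : a < b -> a <= x <= b -> a < approach a b x n < b.
Proof.
  intros Hab Hx. unfold approach, Rdiv. pose proof (inv_INR_S_bounds n).
  set (r := / (INR n + 1)) in *. nra.
Qed.

Lemma approach_lim (a b x : R) : is_lim_seq (approach a b x) x.
Proof.
  unfold approach. replace (Finite x) with (Finite (x + ((a + b) / 2 - x) * 0)) by (f_equal; ring).
  apply is_lim_seq_plus'; [apply is_lim_seq_const|].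
  apply is_lim_seq_mult'; [apply is_lim_seq_const|].
  replace (Finite 0) with (Rbar_inv p_infty) by reflexivity.
  apply is_lim_seq_inv; [|discriminate].
  eapply is_lim_seq_plus; [apply is_lim_seq_INR|apply is_lim_seq_const|reflexivity].
Qed.

(** Completeness of R: under the Cauchy criterion the total operator [lim] is a genuine limit. *)
Lemma filterlim_cauchy {T : Type} (F : (T -> Prop) -> Prop) {FF : ProperFilter F} (v : T -> R) :
  (forall eps : posreal, exists Q, F Q /\ forall z z', Q z -> Q z' -> Rabs (v z - v z') < eps) ->
  filterlim v F (locally (@lim R_CompleteSpace (filtermap v F))).
Proof.
  intros Hc. apply filterlim_locally.
  apply (complete_cauchy (T := R_CompleteSpace) (filtermap v F)).
  - apply filtermap_proper_filter; exact FF.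
  - intros eps. destruct (Hc eps) as [Q [HQ H]].
    destruct (filter_ex Q HQ) as [z0 Hz0]. exists (v z0).
    unfold filtermap. apply filter_imp with Q; [|exact HQ].
    intros z Hz. exact (H z z0 Hz Hz0).
Qed.

(** Properness at boundary points comes from [approach]: the open rectangle accumulates at every
    point of its closure. *)
Lemma within_rect_proper (a b c d x y : R) :
  a < b -> c < d -> a <= x <= b -> c <= y <= d ->
  ProperFilter (within (fun z : R * R => rect a b c d (fst z) (snd z)) (locally (x, y))).
Proof.
  intros Hab Hcd Hx Hy. constructor; [|apply within_filter; apply locally_filter].
  intros Q [eps HQ].
  pose proof (proj2 (is_lim_seq_spec _ _) (approach_lim a b x) eps) as [n1 H1].
  pose proof (proj2 (is_lim_seq_spec _ _) (approach_lim c d y) eps) as [n2 H2].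
  exists (approach a b x n1, approach c d y n2). apply HQ.
  - split; [apply (H1 n1); lia|apply (H2 n2); lia].
  - split; apply approach_in; assumption.
Qed.

(** Uniform continuity makes the values near (x, y) Cauchy, so the limit may be taken along any
    interior sequence. Arbitrary sequences are allowed so that an edge can be approached along its
    normal, with the other coordinate fixed. *)
Lemma extension_seq (v : R -> R -> R) (a b c d x y : R) (X Y : nat -> R) :
  a < b -> c < d -> a <= x <= b -> c <= y <= d -> uc_on (rect a b c d) v ->
  is_lim_seq X x -> is_lim_seq Y y -> (forall n, rect a b c d (X n) (Y n)) ->
  is_lim_seq (fun n => v (X n) (Y n)) (extension (rect a b c d) v x y).
Proof.
  intros Hab Hcd Hx Hy Hv HX HY HXY.
  pose proof (within_rect_proper a b c d x y Hab Hcd Hx Hy) as HF.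
  assert (HL : filterlim (fun z : R * R => v (fst z) (snd z))
     (within (fun z : R * R => rect a b c d (fst z) (snd z)) (locally (x, y)))
     (locally (extension (rect a b c d) v x y))).
  { apply filterlim_cauchy; [exact HF|]. intros eps. destruct (Hv eps) as [delta Hd].
    assert (Hd2 : 0 < delta / 2) by (destruct delta; simpl; lra).
    exists (fun z => rect a b c d (fst z) (snd z) /\ ball (x, y) (mkposreal _ Hd2) z). split.
    - exists (mkposreal _ Hd2). intros z Hz HA. split; assumption.
    - intros z z' [Hz [B1 B2]] [Hz' [B1' B2']].
      change (Rabs (fst z - x) < delta / 2) in B1. change (Rabs (fst z' - x) < delta / 2) in B1'.
      change (Rabs (snd z - y) < delta / 2) in B2. change (Rabs (snd z' - y) < delta / 2) in B2'.
      apply Hd; try assumption.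
      + replace (fst z - fst z') with ((fst z - x) - (fst z' - x)) by ring.
        eapply Rle_lt_trans; [apply Rabs_triang|]. rewrite Rabs_Ropp. lra.
      + replace (snd z - snd z') with ((snd z - y) - (snd z' - y)) by ring.
        eapply Rle_lt_trans; [apply Rabs_triang|]. rewrite Rabs_Ropp. lra. }
  refine (filterlim_comp _ _ _ (fun n => (X n, Y n)) (fun z : R * R => v (fst z) (snd z))
    eventually _ (locally (extension (rect a b c d) v x y)) _ HL).
  intros Q [eps HQ]. unfold filtermap.
  pose proof (proj2 (is_lim_seq_spec _ _) HX eps) as [n1 H1].
  pose proof (proj2 (is_lim_seq_spec _ _) HY eps) as [n2 H2].
  exists (n1 + n2)%nat. intros n Hn. apply HQ; [|apply HXY].
  split; [apply (H1 n); lia|apply (H2 n); lia].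
Qed.

Lemma extension_approach (v : R -> R -> R) (a b c d x y : R) :
  a < b -> c < d -> a <= x <= b -> c <= y <= d -> uc_on (rect a b c d) v ->
  is_lim_seq (fun n => v (approach a b x n) (approach c d y n)) (extension (rect a b c d) v x y).
Proof.
  intros. apply extension_seq; auto using approach_lim.
  intros n. split; apply approach_in; assumption.
Qed.

Lemma extension_comb (v w e : R -> R -> R) (al be a b c d x y : R) :
  a < b -> c < d -> a <= x <= b -> c <= y <= d ->
  uc_on (rect a b c d) v -> uc_on (rect a b c d) w -> uc_on (rect a b c d) e ->
  (forall s t, rect a b c d s t -> e s t = al * v s t + be * w s t) ->
  extension (rect a b c d) e x y
  = al * extension (rect a b c d) v x y + be * extension (rect a b c d) w x y.
Proof.
  intros Hab Hcd Hx Hy Hv Hw He Heq.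
  pose proof (extension_approach e a b c d x y Hab Hcd Hx Hy He) as H1.
  pose proof (extension_approach v a b c d x y Hab Hcd Hx Hy Hv) as H2.
  pose proof (extension_approach w a b c d x y Hab Hcd Hx Hy Hw) as H3.
  apply is_lim_seq_unique in H1.
  assert (H4 : is_lim_seq (fun n => e (approach a b x n) (approach c d y n))
    (al * extension (rect a b c d) v x y + be * extension (rect a b c d) w x y)).
  { eapply is_lim_seq_ext.
    - intros n. symmetry. apply Heq. split; apply approach_in; assumption.
    - apply is_lim_seq_plus'; apply is_lim_seq_mult'; auto using is_lim_seq_const. }
  apply is_lim_seq_unique in H4. rewrite H1 in H4. injection H4. auto.
Qed.

Lemma extension_eq (v e : R -> R -> R) (a b c d x y : R) :
  a < b -> c < d -> a <= x <= b -> c <= y <= d ->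
  uc_on (rect a b c d) v -> (forall s t, rect a b c d s t -> e s t = v s t) ->
  extension (rect a b c d) e x y = extension (rect a b c d) v x y.
Proof.
  intros Hab Hcd Hx Hy Hv Heq.
  assert (He : uc_on (rect a b c d) e).
  { intros eps. destruct (Hv eps) as [delta H]. exists delta.
    intros s t s' t' H1 H2. rewrite !Heq by assumption. auto. }
  rewrite (extension_comb v v e 1 0 a b c d x y); auto; [ring|].
  intros s t Hst. rewrite Heq by assumption. ring.
Qed.

(** * Taylor's formula up to the boundary of a rectangle *)

Definition taylor_poly2 (w : nat -> nat -> R) (k : nat) (x y : R) : R :=
  taylor_poly (fun n => taylor_poly (fun m => w m n) (k - n) x) k y.

(** A class that survives a first partial derivative at the cost of one order ([regular_dx],
    [regular_dy]), so that fluxes are treated like the solution itself. *)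
Record regular (A : R -> R -> Prop) (v : R -> R -> R) (k : nat) : Prop := Regular {
  regular_diff : forall x y, A x y -> ex_diff_n v k x y;
  regular_uc : forall m n, (m + n <= k)%nat -> uc_on A (partial_derive m n v);
  regular_lip : forall m n, (m + n = k)%nat -> lipschitz_on A (partial_derive m n v)
}.

Lemma ex_derive_n_row (A : R -> R -> Prop) (v : R -> R -> R) (k m n : nat) (x y : R) :
  (forall x y, A x y -> ex_diff_n v k x y) -> A x y -> (m + n <= k)%nat ->
  ex_derive_n (fun s => partial_derive 0 n v s y) m x.
Proof.
  intros Hv HA Hmn. destruct m as [|m]; [exact I|].
  apply (ex_diff_n_ex_deriv_inf_1 k m n) with (f := v); [lia|auto].
Qed.

Lemma ex_derive_n_col (A : R -> R -> Prop) (v : R -> R -> R) (k n : nat) (x y : R) :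
  (forall x y, A x y -> ex_diff_n v k x y) -> A x y -> (n <= k)%nat ->
  ex_derive_n (fun t => v x t) n y.
Proof.
  intros Hv HA Hn. destruct n as [|n]; [exact I|].
  apply (ex_diff_n_ex_deriv_inf_2 k 0 n) with (f := v); [lia|auto].
Qed.

Lemma lipschitz_bound (A : R -> R -> Prop) (v : R -> R -> R) :
  lipschitz_on A v -> exists K, 0 <= K /\ forall x y x' y', A x y -> A x' y' ->
    Rabs (v x y - v x' y') <= K * (Rabs (x - x') + Rabs (y - y')).
Proof.
  intros [K HK]. exists (Rabs K). split; [apply Rabs_pos|]. intros x y x' y' H H'.
  eapply Rle_trans; [apply HK; assumption|].
  pose proof (Rabs_pos (x - x')). pose proof (Rabs_pos (y - y')). pose proof (Rle_abs K).
  apply Rmult_le_compat_r; lra.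
Qed.

(** The x-expansion of the n-th y-derivative stops at order k - n, where the partial has total order
    k and is Lipschitz; one constant serves all rows y. *)
Lemma taylor_row (a b c d : R) (v : R -> R -> R) (k n : nat) :
  regular (rect a b c d) v k -> (n <= k)%nat ->
  exists K, 0 <= K /\ forall x0 x1 y, rect a b c d x0 y -> rect a b c d x1 y ->
    Rabs (partial_derive 0 n v x1 y
          - taylor_poly (fun m => partial_derive m n v x0 y) (k - n) (x1 - x0))
    <= K * Rabs (x1 - x0) ^ S (k - n).
Proof.
  intros Hr Hn. destruct (lipschitz_bound _ _ (regular_lip _ _ _ Hr (k - n) n ltac:(lia))) as [K [HK0 HK]].
  exists K. split; [exact HK0|]. intros x0 x1 y H0 H1.
  destruct (taylor_interval (fun s => partial_derive 0 n v s y) (k - n) a b x0 x1) as [z [Hz [Hzx Heq]]].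
  - intros t Ht j Hj. apply (ex_derive_n_row (rect a b c d) v k); [apply Hr| |lia].
    split; [exact Ht|apply H0].
  - apply H0.
  - apply H1.
  - rewrite Heq. unfold Rminus at 1.
    change (fun j : nat => Derive_n (fun s : R => partial_derive 0 n v s y) j x0)
      with (fun m => partial_derive m n v x0 y).
    change (Derive_n (fun s : R => partial_derive 0 n v s y) (k - n))
      with (fun s => partial_derive (k - n) n v s y). cbv beta.
    match goal with |- Rabs ?e <= _ => replace e with
      ((partial_derive (k - n) n v z y - partial_derive (k - n) n v x0 y) * mono (x1 - x0) (k - n)) by ring end.
    rewrite Rabs_mult. simpl pow. rewrite <- Rmult_assoc.
    apply Rmult_le_compat; try apply Rabs_pos; [|apply Rabs_mono_le].
    eapply Rle_trans; [apply HK; [split; [exact Hz|apply H0]|exact H0]|].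
    replace (y - y) with 0 by ring. rewrite Rabs_R0. nra.
Qed.

Lemma taylor_col (a b c d : R) (v : R -> R -> R) (k : nat) :
  regular (rect a b c d) v k ->
  exists K, 0 <= K /\ forall x y0 y1, rect a b c d x y0 -> rect a b c d x y1 ->
    Rabs (v x y1 - taylor_poly (fun n => partial_derive 0 n v x y0) k (y1 - y0))
    <= K * Rabs (y1 - y0) ^ S k.
Proof.
  intros Hr. destruct (lipschitz_bound _ _ (regular_lip _ _ _ Hr 0 k ltac:(lia))) as [K [HK0 HK]].
  exists K. split; [exact HK0|]. intros x y0 y1 H0 H1.
  destruct (taylor_interval (fun t => v x t) k c d y0 y1) as [z [Hz [Hzx Heq]]].
  - intros t Ht j Hj. apply (ex_derive_n_col (rect a b c d) v k); [apply Hr| |lia].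
    split; [apply H0|exact Ht].
  - apply H0.
  - apply H1.
  - rewrite Heq. unfold Rminus at 1.
    change (fun j : nat => Derive_n (fun t : R => v x t) j y0)
      with (fun n => partial_derive 0 n v x y0).
    change (Derive_n (fun t : R => v x t) k) with (fun t => partial_derive 0 k v x t). cbv beta.
    match goal with |- Rabs ?e <= _ => replace e with
      ((partial_derive 0 k v x z - partial_derive 0 k v x y0) * mono (y1 - y0) k) by ring end.
    rewrite Rabs_mult. simpl pow. rewrite <- Rmult_assoc.
    apply Rmult_le_compat; try apply Rabs_pos; [|apply Rabs_mono_le].
    eapply Rle_trans; [apply HK; [split; [apply H0|exact Hz]|exact H0]|].
    replace (x - x) with 0 by ring. rewrite Rabs_R0. nra.
Qed.

Lemma taylor_poly_minus (c d : nat -> R) (k : nat) (t : R) :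
  taylor_poly c k t - taylor_poly d k t = taylor_poly (fun n => c n - d n) k t.
Proof.
  unfold taylor_poly. rewrite <- minus_sum. apply sum_eq. intros; ring.
Qed.

(** Finitely many constants are merged by adding them, since each property survives an increase of
    its constant. *)
Lemma uniform_constant (Q : nat -> R -> Prop) (k : nat) :
  (forall n K K', Q n K -> K <= K' -> Q n K') ->
  (forall n, (n <= k)%nat -> exists K, 0 <= K /\ Q n K) ->
  exists K, 0 <= K /\ forall n, (n <= k)%nat -> Q n K.
Proof.
  intros Hmon HQ. induction k as [|k IH].
  - destruct (HQ 0%nat (Nat.le_refl _)) as [K [HK H]]. exists K. split; [exact HK|].
    intros n Hn. replace n with 0%nat by lia. exact H.
  - destruct IH as [K1 [HK1 H1]]; [intros; apply HQ; lia|].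
    destruct (HQ (S k) (Nat.le_refl _)) as [K2 [HK2 H2]].
    exists (K1 + K2). split; [lra|]. intros n Hn.
    destruct (Nat.eq_dec n (S k)) as [->|Hne].
    + apply Hmon with K2; [exact H2|lra].
    + apply Hmon with K1; [apply H1; lia|lra].
Qed.

(** Expansion along a path with one corner: in y along x = x1, then each coefficient in x at height
    y0. A rectangle contains the corner point (x1, y0). *)
Lemma taylor_interior (a b c d : R) (v : R -> R -> R) (k : nat) :
  regular (rect a b c d) v k ->
  exists K, 0 <= K /\ forall x0 y0 x1 y1, rect a b c d x0 y0 -> rect a b c d x1 y1 ->
    Rabs (v x1 y1 - taylor_poly2 (fun m n => partial_derive m n v x0 y0) k (x1 - x0) (y1 - y0))
    <= K * (Rabs (x1 - x0) + Rabs (y1 - y0)) ^ S k.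
Proof.
  intros Hr. destruct (taylor_col a b c d v k Hr) as [K1 [HK1 H1]].
  destruct (uniform_constant (fun n K => forall x0 x1 y, rect a b c d x0 y -> rect a b c d x1 y ->
    Rabs (partial_derive 0 n v x1 y
          - taylor_poly (fun m => partial_derive m n v x0 y) (k - n) (x1 - x0))
    <= K * Rabs (x1 - x0) ^ S (k - n)) k) as [K2 [HK2 H2]].
  { intros n K K' HK HKK x0 x1 y Hx0 Hx1. eapply Rle_trans; [apply HK; assumption|].
    apply Rmult_le_compat_r; [apply pow_le, Rabs_pos|exact HKK]. }
  { intros n Hn. apply taylor_row; assumption. }
  exists (K1 + INR (S k) * K2). split.
  { pose proof (pos_INR (S k)). nra. }
  intros x0 y0 x1 y1 Hz0 Hz1.
  assert (Hz10 : rect a b c d x1 y0) by (split; [apply Hz1|apply Hz0]).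
  set (r := Rabs (x1 - x0) + Rabs (y1 - y0)).
  pose proof (Rabs_pos (x1 - x0)). pose proof (Rabs_pos (y1 - y0)).
  replace (_ - _) with
    ((v x1 y1 - taylor_poly (fun n => partial_derive 0 n v x1 y0) k (y1 - y0))
     + (taylor_poly (fun n => partial_derive 0 n v x1 y0) k (y1 - y0)
        - taylor_poly2 (fun m n => partial_derive m n v x0 y0) k (x1 - x0) (y1 - y0))) by ring.
  eapply Rle_trans; [apply Rabs_triang|]. rewrite Rmult_plus_distr_r.
  apply Rplus_le_compat.
  - eapply Rle_trans; [apply H1; assumption|].
    apply Rmult_le_compat_l; [exact HK1|]. apply pow_incr. unfold r. lra.
  - unfold taylor_poly2. rewrite taylor_poly_minus. unfold taylor_poly at 1.
    eapply Rle_trans; [apply Rsum_abs|].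
    rewrite Rmult_assoc, Rmult_comm, <- sum_cte. apply sum_Rle. intros n Hn.
    rewrite Rabs_mult.
    (* The n-th coefficient contributes r^(k-n+1) by its own remainder and r^n by the monomial in
       y. *)
    replace (r ^ S k) with (r ^ S (k - n) * r ^ n) by (rewrite <- pow_add; f_equal; lia).
    rewrite <- Rmult_assoc. apply Rmult_le_compat; try apply Rabs_pos.
    + eapply Rle_trans; [apply H2; assumption|].
      apply Rmult_le_compat_l; [exact HK2|]. apply pow_incr. unfold r. lra.
    + eapply Rle_trans; [apply Rabs_mono_le|]. apply pow_incr. unfold r. lra.
Qed.

Lemma is_lim_seq_mono (X : nat -> R) (x : R) (n : nat) :
  is_lim_seq X x -> is_lim_seq (fun i => mono (X i) n) (mono x n).
Proof.
  intros HX. apply (is_lim_seq_continuous (fun t => mono t n)); [|exact HX].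
  unfold mono, Rdiv. apply derivable_continuous. reg.
Qed.

Lemma is_lim_seq_taylor_poly (C : nat -> nat -> R) (c : nat -> R) (X : nat -> R) (x : R) (k : nat) :
  (forall n, (n <= k)%nat -> is_lim_seq (fun i => C i n) (c n)) -> is_lim_seq X x ->
  is_lim_seq (fun i => taylor_poly (C i) k (X i)) (taylor_poly c k x).
Proof.
  intros HC HX. unfold taylor_poly. induction k as [|k IH]; simpl.
  - apply is_lim_seq_mult'; [apply HC; lia|apply is_lim_seq_mono, HX].
  - apply is_lim_seq_plus'; [apply IH; intros; apply HC; lia|].
    apply is_lim_seq_mult'; [apply HC; lia|apply is_lim_seq_mono, HX].
Qed.

(** The interior constant depends on neither point, so the inequality passes to the limit as both
    points move to the boundary. *)
Lemma taylor_closure (a b c d : R) (v : R -> R -> R) (k : nat) :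
  a < b -> c < d -> regular (rect a b c d) v k ->
  exists K, 0 <= K /\ forall x0 y0 x1 y1,
    a <= x0 <= b -> c <= y0 <= d -> a <= x1 <= b -> c <= y1 <= d ->
    Rabs (extension (rect a b c d) v x1 y1
          - taylor_poly2 (fun m n => extension (rect a b c d) (partial_derive m n v) x0 y0)
              k (x1 - x0) (y1 - y0))
    <= K * (Rabs (x1 - x0) + Rabs (y1 - y0)) ^ S k.
Proof.
  intros Hab Hcd Hr. destruct (taylor_interior a b c d v k Hr) as [K [HK H]].
  exists K. split; [exact HK|]. intros x0 y0 x1 y1 Hx0 Hy0 Hx1 Hy1.
  set (X0 := approach a b x0). set (Y0 := approach c d y0).
  set (X1 := approach a b x1). set (Y1 := approach c d y1).
  assert (HX : is_lim_seq (fun i => X1 i - X0 i) (x1 - x0))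
    by (apply is_lim_seq_minus'; apply approach_lim).
  assert (HY : is_lim_seq (fun i => Y1 i - Y0 i) (y1 - y0))
    by (apply is_lim_seq_minus'; apply approach_lim).
  refine (is_lim_seq_le (fun i => Rabs (v (X1 i) (Y1 i)
      - taylor_poly2 (fun m n => partial_derive m n v (X0 i) (Y0 i)) k (X1 i - X0 i) (Y1 i - Y0 i)))
    (fun i => K * (Rabs (X1 i - X0 i) + Rabs (Y1 i - Y0 i)) ^ S k)
    (Finite _) (Finite _) _ _ _).
  - intros i. apply H; split; apply approach_in; assumption.
  - apply (is_lim_seq_abs _ (Finite _)). apply is_lim_seq_minus'.
    + apply extension_approach; try assumption. apply (regular_uc _ _ _ Hr 0 0). lia.
    + unfold taylor_poly2.
      apply (is_lim_seq_taylor_poly (fun i n => taylor_poly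
        (fun m => partial_derive m n v (X0 i) (Y0 i)) (k - n) (X1 i - X0 i))); [|exact HY].
      intros n Hn.
      apply (is_lim_seq_taylor_poly (fun i m => partial_derive m n v (X0 i) (Y0 i))); [|exact HX].
      intros m Hm. apply extension_approach; try assumption. apply Hr. lia.
  - apply is_lim_seq_mult'; [apply is_lim_seq_const|].
    apply (is_lim_seq_continuous (fun t => t ^ S k)); [apply derivable_continuous; reg|].
    apply is_lim_seq_plus'; apply (is_lim_seq_abs _ (Finite _)); assumption.
Qed.

(** * Partial derivatives on an open rectangle *)

Lemma rect_open (a b c d x y : R) : rect a b c d x y -> locally_2d (rect a b c d) x y.
Proof.
  intros [Hx Hy].
  assert (He : 0 < Rmin (Rmin (x - a) (b - x)) (Rmin (y - c) (d - y)))
    by (repeat apply Rmin_pos; lra).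
  exists (mkposreal _ He). simpl. intros s t Hs Ht.
  pose proof (Rmin_l (Rmin (x - a) (b - x)) (Rmin (y - c) (d - y))).
  pose proof (Rmin_r (Rmin (x - a) (b - x)) (Rmin (y - c) (d - y))).
  pose proof (Rmin_l (x - a) (b - x)). pose proof (Rmin_r (x - a) (b - x)).
  pose proof (Rmin_l (y - c) (d - y)). pose proof (Rmin_r (y - c) (d - y)).
  apply Rabs_def2 in Hs. apply Rabs_def2 in Ht. split; lra.
Qed.

Lemma rect_locally (a b c d x y : R) (Q : R -> R -> Prop) :
  (forall s t, rect a b c d s t -> Q s t) -> rect a b c d x y -> locally_2d Q x y.
Proof.
  intros HQ Hxy. destruct (rect_open a b c d x y Hxy) as [e He].
  exists e. intros s t Hs Ht. apply HQ. apply He; assumption.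
Qed.

Lemma rect_row_ext (a b c d x y : R) (f g : R -> R) (n : nat) :
  (forall s, rect a b c d s y -> f s = g s) -> rect a b c d x y ->
  Derive_n f n x = Derive_n g n x.
Proof.
  intros Hfg [Hx Hy]. apply Derive_n_ext_loc.
  apply (locally_interval _ x a b); simpl; try lra.
  intros s Hs1 Hs2. apply Hfg. simpl in *. split; lra.
Qed.

Lemma rect_col_ext (a b c d x y : R) (f g : R -> R) (n : nat) :
  (forall t, rect a b c d x t -> f t = g t) -> rect a b c d x y ->
  Derive_n f n y = Derive_n g n y.
Proof.
  intros Hfg [Hx Hy]. apply Derive_n_ext_loc.
  apply (locally_interval _ y c d); simpl; try lra.
  intros s Hs1 Hs2. apply Hfg. simpl in *. split; lra.
Qed.

(** In [partial_derive] the y-derivatives are inside and the x-derivatives outside. An inner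
    x-derivative must therefore be exchanged with the y-derivatives, which takes differentiability;
    the y-shift below is mere composition. *)
Lemma partial_derive_shift_x (a b c d : R) (v : R -> R -> R) (k m n : nat) (x y : R) :
  (forall s t, rect a b c d s t -> ex_diff_n v k s t) -> (S (m + n) <= k)%nat ->
  rect a b c d x y ->
  partial_derive m n (partial_derive 1 0 v) x y = partial_derive (S m) n v x y.
Proof.
  intros Hv Hmn Hxy.
  replace (S m) with (m + 1)%nat by lia. replace n with (0 + n)%nat at 2 by lia.
  rewrite <- (partial_derive_add_zero v m 0 1 n) by auto.
  change (Derive_n (fun s => partial_derive 0 n (partial_derive 1 0 v) s y) m x
    = Derive_n (fun s => partial_derive 1 n v s y) m x).
  apply (rect_row_ext a b c d x y); [|exact Hxy].
  intros s Hs. symmetry. apply Derive_partial_derive_aux1.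
  apply (rect_locally a b c d); [|exact Hs].
  intros s' t' H. apply ex_diff_n_m with k; [lia|apply Hv, H].
Qed.

Lemma partial_derive_shift_y (v : R -> R -> R) (r m n : nat) (x y : R) :
  partial_derive m n (partial_derive 0 r v) x y = partial_derive m (n + r) v x y.
Proof.
  rewrite partial_derive_add_zero by auto. f_equal. lia.
Qed.

Lemma uc_on_ext (A : R -> R -> Prop) (v w : R -> R -> R) :
  (forall x y, A x y -> v x y = w x y) -> uc_on A v -> uc_on A w.
Proof.
  intros H Hv eps. destruct (Hv eps) as [delta Hd]. exists delta.
  intros x y x' y' H1 H2. rewrite <- !H by assumption. auto.
Qed.

Lemma lipschitz_on_ext (A : R -> R -> Prop) (v w : R -> R -> R) :
  (forall x y, A x y -> v x y = w x y) -> lipschitz_on A v -> lipschitz_on A w.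
Proof.
  intros H [K HK]. exists K.
  intros x y x' y' H1 H2. rewrite <- !H by assumption. auto.
Qed.

Lemma regular_dx (a b c d : R) (v : R -> R -> R) (k : nat) :
  regular (rect a b c d) v (S k) -> regular (rect a b c d) (partial_derive 1 0 v) k.
Proof.
  intros Hr. constructor.
  - intros x y H. replace k with (S k - (1 + 0))%nat by lia.
    apply ex_diff_n_deriv; [lia|apply Hr, H].
  - intros m n Hmn. apply uc_on_ext with (partial_derive (S m) n v); [|apply Hr; lia].
    intros x y H. symmetry. apply (partial_derive_shift_x a b c d v (S k)); [apply Hr|lia|exact H].
  - intros m n Hmn. apply lipschitz_on_ext with (partial_derive (S m) n v); [|apply Hr; lia].
    intros x y H. symmetry. apply (partial_derive_shift_x a b c d v (S k)); [apply Hr|lia|exact H].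
Qed.

Lemma regular_dy (a b c d : R) (v : R -> R -> R) (k : nat) :
  regular (rect a b c d) v (S k) -> regular (rect a b c d) (partial_derive 0 1 v) k.
Proof.
  intros Hr. constructor.
  - intros x y H. replace k with (S k - (0 + 1))%nat by lia.
    apply ex_diff_n_deriv; [lia|apply Hr, H].
  - intros m n Hmn. apply uc_on_ext with (partial_derive m (n + 1) v); [|apply Hr; lia].
    intros x y H. symmetry. apply partial_derive_shift_y.
  - intros m n Hmn. apply lipschitz_on_ext with (partial_derive m (n + 1) v); [|apply Hr; lia].
    intros x y H. symmetry. apply partial_derive_shift_y.
Qed.

Lemma partial_derive_plus (a b c d : R) (v w : R -> R -> R) (k m n : nat) (x y : R) :
  (forall s t, rect a b c d s t -> ex_diff_n v k s t) ->
  (forall s t, rect a b c d s t -> ex_diff_n w k s t) ->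
  (m + n <= k)%nat -> rect a b c d x y ->
  partial_derive m n (fun s t => v s t + w s t) x y
  = partial_derive m n v x y + partial_derive m n w x y.
Proof.
  intros Hv Hw Hmn Hxy.
  transitivity (Derive_n (fun s => partial_derive 0 n v s y + partial_derive 0 n w s y) m x).
  - apply (rect_row_ext a b c d x y); [|exact Hxy]. intros s [Hs Hy].
    apply Derive_n_plus; apply (locally_interval _ y c d); simpl; try lra;
      intros t Ht1 Ht2 j Hj; simpl in *.
    + apply (ex_derive_n_col (rect a b c d) v k); [exact Hv|split; lra|lia].
    + apply (ex_derive_n_col (rect a b c d) w k); [exact Hw|split; lra|lia].
  - destruct Hxy as [Hx Hy].
    apply Derive_n_plus; apply (locally_interval _ x a b); simpl; try lra;
      intros s Hs1 Hs2 j Hj; simpl in *.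
    + apply (ex_derive_n_row (rect a b c d) v k); [exact Hv|split; lra|lia].
    + apply (ex_derive_n_row (rect a b c d) w k); [exact Hw|split; lra|lia].
Qed.

Lemma partial_derive_scal (r : R) (v : R -> R -> R) (m n : nat) (x y : R) :
  partial_derive m n (fun s t => r * v s t) x y = r * partial_derive m n v x y.
Proof.
  unfold partial_derive. rewrite <- Derive_n_scal_l. apply Derive_n_ext.
  intros s. apply Derive_n_scal_l.
Qed.

Lemma partial_derive_rect_ext (a b c d : R) (v w : R -> R -> R) (m n : nat) (x y : R) :
  (forall s t, rect a b c d s t -> v s t = w s t) -> rect a b c d x y ->
  partial_derive m n v x y = partial_derive m n w x y.
Proof.
  intros H Hxy. apply partial_derive_ext_loc. apply (rect_locally a b c d); assumption.
Qed.

Lemma partial_derive_laplacian (a b c d r : R) (v e : R -> R -> R) (k m n : nat) (x y : R) :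
  (forall s t, rect a b c d s t -> ex_diff_n v (S (S k)) s t) ->
  (forall s t, rect a b c d s t ->
     e s t = - (r * (partial_derive 2 0 v s t + partial_derive 0 2 v s t))) ->
  (m + n <= k)%nat -> rect a b c d x y ->
  partial_derive m n e x y
  = - (r * (partial_derive (S (S m)) n v x y + partial_derive m (S (S n)) v x y)).
Proof.
  intros Hv He Hmn Hxy.
  assert (Hsh : forall p q s t, (p + q <= 2)%nat -> rect a b c d s t ->
    ex_diff_n (partial_derive p q v) k s t).
  { intros p q s t Hpq H. apply ex_diff_n_m with (S (S k) - (p + q))%nat; [lia|].
    apply ex_diff_n_deriv; [lia|apply Hv, H]. }
  rewrite (partial_derive_rect_ext a b c d e
    (fun s t => - r * (partial_derive 2 0 v s t + partial_derive 0 2 v s t)))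
    by (try assumption; intros; rewrite He by assumption; ring).
  rewrite partial_derive_scal.
  rewrite (partial_derive_plus a b c d (partial_derive 2 0 v) (partial_derive 0 2 v) k)
    by (try assumption; intros; apply Hsh; auto).
  rewrite partial_derive_shift_y.
  replace (n + 2)%nat with (S (S n)) by lia.
  assert (H2 : partial_derive m n (partial_derive 2 0 v) x y = partial_derive (S (S m)) n v x y).
  (* The shift moves one x-derivative at a time, so the second derivative is split in two. *)
  { transitivity (partial_derive m n (partial_derive 1 0 (partial_derive 1 0 v)) x y).
    - apply (partial_derive_rect_ext a b c d); [|exact Hxy]. intros s t H.
      symmetry. apply (partial_derive_add_zero v 1 0 1 0). auto.
    - rewrite (partial_derive_shift_x a b c d _ (S k)); [|clear x y Hxy; intros x y H|lia|exact Hxy].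
      + apply (partial_derive_shift_x a b c d v (S (S k))); [exact Hv|lia|exact Hxy].
      + replace (S k) with (S (S k) - (1 + 0))%nat by lia.
        apply ex_diff_n_deriv; [lia|apply Hv, H]. }
  rewrite H2. ring.
Qed.

(** * Jumps across an edge *)

Lemma taylor_poly_ext (c d : nat -> R) (k : nat) (t : R) :
  (forall n, (n <= k)%nat -> c n = d n) -> taylor_poly c k t = taylor_poly d k t.
Proof. intros H. apply sum_eq. intros n Hn. rewrite H by assumption. reflexivity. Qed.

Lemma expands_of_bound (D : R -> R) (z s : R) (k : nat) (c : nat -> R) (K eta : R) :
  0 <= K -> 0 < eta ->
  (forall t, 0 < t < eta -> Rabs (D (z + s * t) - taylor_poly c k (s * t)) <= K * t ^ S k) ->
  expands D z s k c.
Proof.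
  intros HK Heta H eps He.
  assert (He' : 0 < eps / (K + 1)) by (apply Rdiv_lt_0_compat; lra).
  exists (Rmin eta (eps / (K + 1))). split; [apply Rmin_pos; assumption|]. intros t Ht.
  pose proof (Rmin_l eta (eps / (K + 1))). pose proof (Rmin_r eta (eps / (K + 1))).
  eapply Rle_trans; [apply H; lra|]. simpl pow. rewrite <- Rmult_assoc.
  apply Rmult_le_compat_r; [apply pow_le; lra|].
  replace eps with ((K + 1) * (eps / (K + 1))) by (field; lra). nra.
Qed.

(** Along a vertical edge the x-increment is zero, and the formula on the closed rectangle collapses
    to its terms with m = 0. *)
Lemma expands_edge_y (a b c d x0 y0 s eta : R) (v : R -> R -> R) (k : nat) :
  a < b -> c < d -> regular (rect a b c d) v k ->
  a <= x0 <= b -> c <= y0 <= d -> Rabs s = 1 -> 0 < eta ->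
  (forall t, 0 < t < eta -> c <= y0 + s * t <= d) ->
  expands (fun y => extension (rect a b c d) v x0 y) y0 s k
    (fun n => extension (rect a b c d) (partial_derive 0 n v) x0 y0).
Proof.
  intros Hab Hcd Hr Hx Hy Hs Heta Hst.
  destruct (taylor_closure a b c d v k Hab Hcd Hr) as [K [HK H]].
  apply expands_of_bound with K eta; try assumption. intros t Ht.
  specialize (H x0 y0 x0 (y0 + s * t) Hx Hy Hx (Hst t Ht)).
  replace (x0 - x0) with 0 in H by ring. replace (y0 + s * t - y0) with (s * t) in H by ring.
  rewrite Rabs_R0, Rabs_mult, Hs, (Rabs_pos_eq t), Rplus_0_l, Rmult_1_l in H by lra.
  unfold taylor_poly2 in H.
  erewrite taylor_poly_ext in H; [exact H|].
  intros n Hn. cbv beta. rewrite taylor_poly_0. reflexivity.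
Qed.

Lemma expands_edge_x (a b c d x0 y0 s eta : R) (v : R -> R -> R) (k : nat) :
  a < b -> c < d -> regular (rect a b c d) v k ->
  a <= x0 <= b -> c <= y0 <= d -> Rabs s = 1 -> 0 < eta ->
  (forall t, 0 < t < eta -> a <= x0 + s * t <= b) ->
  expands (fun x => extension (rect a b c d) v x y0) x0 s k
    (fun m => extension (rect a b c d) (partial_derive m 0 v) x0 y0).
Proof.
  intros Hab Hcd Hr Hx Hy Hs Heta Hst.
  destruct (taylor_closure a b c d v k Hab Hcd Hr) as [K [HK H]].
  apply expands_of_bound with K eta; try assumption. intros t Ht.
  specialize (H x0 y0 (x0 + s * t) y0 Hx Hy (Hst t Ht) Hy).
  replace (y0 - y0) with 0 in H by ring. replace (x0 + s * t - x0) with (s * t) in H by ring.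
  rewrite Rabs_R0, Rabs_mult, Hs, (Rabs_pos_eq t), Rplus_0_r, Rmult_1_l in H by lra.
  unfold taylor_poly2 in H. rewrite taylor_poly_0, Nat.sub_0_r in H. exact H.
Qed.

(** The target point y stays fixed while the base point moves to z through the interval; uniform
    continuity bounds the remainder by eps |y - X i|^N throughout. Such data give only an o(t^N)
    remainder, which is all that [expands] demands. *)
Lemma expands_uc_derivs (D : R -> R) (a b z s eta : R) (N : nat) (c : nat -> R) :
  a < b -> a <= z <= b -> uc_derivs (fun t => a < t < b) D N ->
  (forall n, (n <= N)%nat -> is_lim_seq (fun i => Derive_n D n (approach a b z i)) (c n)) ->
  Rabs s = 1 -> 0 < eta -> (forall t, 0 < t < eta -> a < z + s * t < b) ->
  expands D z s N c.
Proof.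
  intros Hab Hz HD Hc Hs Heta Hst eps He.
  destruct (proj2 (HD N (Nat.le_refl _)) (mkposreal _ He)) as [delta Hd]. simpl in Hd.
  exists (Rmin delta eta). split; [apply Rmin_pos; [apply cond_pos|exact Heta]|].
  intros t Ht. pose proof (Rmin_l delta eta). pose proof (Rmin_r delta eta).
  set (y := z + s * t). set (X := approach a b z).
  assert (Hy : a < y < b) by (apply Hst; lra).
  assert (HX : is_lim_seq (fun i => y - X i) (s * t)).
  { replace (s * t) with (y - z) by (unfold y; ring).
    apply is_lim_seq_minus'; [apply is_lim_seq_const|apply approach_lim]. }
  assert (Hst1 : Rabs (s * t) = t) by (rewrite Rabs_mult, Hs, Rabs_pos_eq; lra).
  refine (is_lim_seq_le_loc
    (fun i => Rabs (D y - taylor_poly (fun n => Derive_n D n (X i)) N (y - X i)))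
    (fun i => eps * Rabs (y - X i) ^ N) (Finite _) (Finite _) _ _ _).
  (* The distance from y to X i tends to t < delta, so it is eventually below delta. *)
  - assert (Hg : 0 < delta - t) by lra.
    destruct (proj2 (is_lim_seq_spec _ _) HX (mkposreal _ Hg)) as [n0 Hn0]. simpl in Hn0.
    exists n0. intros i Hi. specialize (Hn0 i Hi).
    assert (Hsm : Rabs (y - X i) < delta).
    { replace (y - X i) with ((y - X i - s * t) + s * t) by ring.
      eapply Rle_lt_trans; [apply Rabs_triang|]. lra. }
    destruct (taylor_interval D N a b (X i) y) as [w [Hw [Hwx Heq]]].
    + intros r Hr j Hj. apply (HD j Hj). exact Hr.
    + apply approach_in; assumption.
    + exact Hy.
    + rewrite Heq. unfold Rminus at 1.
      match goal with |- Rabs ?e <= _ => replace e with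
        ((Derive_n D N w - Derive_n D N (X i)) * mono (y - X i) N) by ring end.
      rewrite Rabs_mult. apply Rmult_le_compat; try apply Rabs_pos; [|apply Rabs_mono_le].
      left. apply Hd; [exact Hw|apply approach_in; assumption|lra].
  - apply (is_lim_seq_abs _ (Finite _)). apply is_lim_seq_minus'; [apply is_lim_seq_const|].
    apply (is_lim_seq_taylor_poly (fun i n => Derive_n D n (X i))); assumption.
  - replace (eps * t ^ N) with (eps * Rabs (s * t) ^ N) by (rewrite Hst1; reflexivity).
    apply is_lim_seq_mult'; [apply is_lim_seq_const|].
    apply (is_lim_seq_continuous (fun t => t ^ N)); [apply derivable_continuous; reg|].
    apply (is_lim_seq_abs _ (Finite _)); assumption.
Qed.

Lemma approach_at_right (a b : R) : a < b -> filterlim (approach a b a) eventually (at_right a).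
Proof.
  intros Hab Q [eps HQ]. pose proof (proj2 (is_lim_seq_spec _ _) (approach_lim a b a) eps) as [n0 H].
  exists n0. intros n Hn. apply HQ; [apply (H n Hn)|]. apply approach_in; lra.
Qed.

Lemma approach_at_left (a b : R) : a < b -> filterlim (approach a b b) eventually (at_left b).
Proof.
  intros Hab Q [eps HQ]. pose proof (proj2 (is_lim_seq_spec _ _) (approach_lim a b b) eps) as [n0 H].
  exists n0. intros n Hn. apply HQ; [apply (H n Hn)|]. apply approach_in; lra.
Qed.

Lemma lim_at_right (v : R -> R) (a b : R) :
  a < b -> uniform_continuity v (fun t => a < t < b) ->
  is_lim_seq (fun i => v (approach a b a i)) (@lim R_CompleteSpace (filtermap v (at_right a))).
Proof.
  intros Hab Hv. apply (filterlim_comp _ _ _ _ _ _ _ _ (approach_at_right a b Hab)).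
  apply filterlim_cauchy; [apply at_right_proper_filter|]. intros eps.
  destruct (Hv eps) as [delta Hd].
  (* The bound b - a keeps the points inside the interval; delta / 2 keeps any two of them within
     delta. *)
  assert (He : 0 < Rmin (delta / 2) (b - a)) by (apply Rmin_pos; destruct delta; simpl; lra).
  exists (fun t => a < t /\ Rabs (t - a) < Rmin (delta / 2) (b - a)). split.
  - exists (mkposreal _ He). intros t Ht Hat. split; [exact Hat|exact Ht].
  - pose proof (Rmin_l (delta / 2) (b - a)). pose proof (Rmin_r (delta / 2) (b - a)).
    intros t t' [H1 H2] [H1' H2']. rewrite Rabs_pos_eq in H2, H2' by lra.
    apply Hd; try lra. apply Rabs_def1; lra.
Qed.

Lemma lim_at_left (v : R -> R) (a b : R) :
  a < b -> uniform_continuity v (fun t => a < t < b) ->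
  is_lim_seq (fun i => v (approach a b b i)) (@lim R_CompleteSpace (filtermap v (at_left b))).
Proof.
  intros Hab Hv. apply (filterlim_comp _ _ _ _ _ _ _ _ (approach_at_left a b Hab)).
  apply filterlim_cauchy; [apply at_left_proper_filter|]. intros eps.
  destruct (Hv eps) as [delta Hd].
  assert (He : 0 < Rmin (delta / 2) (b - a)) by (apply Rmin_pos; destruct delta; simpl; lra).
  exists (fun t => t < b /\ Rabs (t - b) < Rmin (delta / 2) (b - a)). split.
  - exists (mkposreal _ He). intros t Ht Hat. split; [exact Hat|exact Ht].
  - pose proof (Rmin_l (delta / 2) (b - a)). pose proof (Rmin_r (delta / 2) (b - a)).
    intros t t' [H1 H2] [H1' H2']. rewrite Rabs_left in H2, H2' by lra.
    apply Hd; try lra. apply Rabs_def1; lra.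
Qed.

(** A jump condition only asserts that one-sided limits exist; comparing along one sequence S
    identifies such a limit with a multiple of the trace. *)
Lemma trace_eq (F : (R -> Prop) -> Prop) (S : nat -> R) (j w : R -> R) (k e r : R) :
  filterlim S eventually F -> (forall n, j (S n) = k * w (S n)) ->
  is_lim_seq (fun n => w (S n)) e -> filterlim j F (locally r) -> r = k * e.
Proof.
  intros HS Hj Hw Hr.
  assert (H1 : is_lim_seq (fun n => j (S n)) r) by exact (filterlim_comp _ _ _ S j _ _ _ HS Hr).
  assert (H2 : is_lim_seq (fun n => j (S n)) (k * e)).
  { eapply is_lim_seq_ext; [intros n; symmetry; apply Hj|].
    apply is_lim_seq_mult'; [apply is_lim_seq_const|exact Hw]. }
  apply is_lim_seq_unique in H1. apply is_lim_seq_unique in H2.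
  rewrite H1 in H2. injection H2. auto.
Qed.

(** Near the corner D equals the difference of the two traces, each of which expands along the edge;
    uniqueness of expansions does the rest. The quantity J with side factors al and be covers both
    the solution (factors 1) and its flux (factors a_p). *)
Lemma jump_coeffs_x (a x0 b c d y0 s eta al be : R) (v J : R -> R -> R) (D : R -> R)
    (k : nat) (e : nat -> R) :
  a < x0 < b -> c < d -> c <= y0 <= d ->
  regular (rect x0 b c d) v k -> regular (rect a x0 c d) v k ->
  (forall x y, rect x0 b c d x y -> J x y = al * v x y) ->
  (forall x y, rect a x0 c d x y -> J x y = be * v x y) ->
  (forall y, c < y < d -> jump (fun x => J x y) x0 (D y)) ->
  Rabs s = 1 -> 0 < eta -> (forall t, 0 < t < eta -> c < y0 + s * t < d) ->
  expands D y0 s k e ->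
  forall n, (n <= k)%nat ->
    al * extension (rect x0 b c d) (partial_derive 0 n v) x0 y0
    - be * extension (rect a x0 c d) (partial_derive 0 n v) x0 y0 = e n.
Proof.
  intros Hx Hcd Hy Hr2 Hr1 HJ2 HJ1 Hjump Hs Heta Hst HD n Hn.
  apply (expands_unique D y0 s k (fun n =>
    al * extension (rect x0 b c d) (partial_derive 0 n v) x0 y0
    - be * extension (rect a x0 c d) (partial_derive 0 n v) x0 y0) e Hs); try assumption.
  apply (expands_ext (fun y => al * extension (rect x0 b c d) v x0 y
    - be * extension (rect a x0 c d) v x0 y) D y0 s k _ eta Heta).
  - intros t Ht. set (y := y0 + s * t). assert (Hyt : c < y < d) by (apply Hst, Ht).
    destruct (Hjump y Hyt) as [r [l [Hrr [Hll Heq]]]]. rewrite <- Heq. f_equal; [|f_equal]; symmetry.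
    + apply (trace_eq (at_right x0) (approach x0 b x0) (fun x => J x y) (fun x => v x y));
        try assumption.
      * apply approach_at_right; lra.
      * intros i. apply HJ2. split; [apply approach_in; lra|exact Hyt].
      * apply (extension_seq v x0 b c d x0 y _ (fun _ => y)); try lra.
        -- apply (regular_uc _ _ _ Hr2 0 0). lia.
        -- apply approach_lim.
        -- apply is_lim_seq_const.
        -- intros i. split; [apply approach_in; lra|exact Hyt].
    + apply (trace_eq (at_left x0) (approach a x0 x0) (fun x => J x y) (fun x => v x y));
        try assumption.
      * apply approach_at_left; lra.
      * intros i. apply HJ1. split; [apply approach_in; lra|exact Hyt].
      * apply (extension_seq v a x0 c d x0 y _ (fun _ => y)); try lra.
        -- apply (regular_uc _ _ _ Hr1 0 0). lia.
        -- apply approach_lim.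
        -- apply is_lim_seq_const.
        -- intros i. split; [apply approach_in; lra|exact Hyt].
  - apply expands_lin; apply expands_edge_y with eta; try assumption; try lra;
      intros t Ht; specialize (Hst t Ht); lra.
Qed.

Lemma jump_coeffs_y (a b c y0 d x0 s eta al be : R) (v J : R -> R -> R) (D : R -> R)
    (k : nat) (e : nat -> R) :
  a < b -> a <= x0 <= b -> c < y0 < d ->
  regular (rect a b y0 d) v k -> regular (rect a b c y0) v k ->
  (forall x y, rect a b y0 d x y -> J x y = al * v x y) ->
  (forall x y, rect a b c y0 x y -> J x y = be * v x y) ->
  (forall x, a < x < b -> jump (fun y => J x y) y0 (D x)) ->
  Rabs s = 1 -> 0 < eta -> (forall t, 0 < t < eta -> a < x0 + s * t < b) ->
  expands D x0 s k e ->
  forall m, (m <= k)%nat ->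
    al * extension (rect a b y0 d) (partial_derive m 0 v) x0 y0
    - be * extension (rect a b c y0) (partial_derive m 0 v) x0 y0 = e m.
Proof.
  intros Hab Hx Hy Hr2 Hr1 HJ2 HJ1 Hjump Hs Heta Hst HD m Hm.
  apply (expands_unique D x0 s k (fun m =>
    al * extension (rect a b y0 d) (partial_derive m 0 v) x0 y0
    - be * extension (rect a b c y0) (partial_derive m 0 v) x0 y0) e Hs); try assumption.
  apply (expands_ext (fun x => al * extension (rect a b y0 d) v x y0
    - be * extension (rect a b c y0) v x y0) D x0 s k _ eta Heta).
  - intros t Ht. set (x := x0 + s * t). assert (Hxt : a < x < b) by (apply Hst, Ht).
    destruct (Hjump x Hxt) as [r [l [Hrr [Hll Heq]]]]. rewrite <- Heq. f_equal; [|f_equal]; symmetry.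
    + apply (trace_eq (at_right y0) (approach y0 d y0) (fun y => J x y) (fun y => v x y));
        try assumption.
      * apply approach_at_right; lra.
      * intros i. apply HJ2. split; [exact Hxt|apply approach_in; lra].
      * apply (extension_seq v a b y0 d x y0 (fun _ => x)); try lra.
        -- apply (regular_uc _ _ _ Hr2 0 0). lia.
        -- apply is_lim_seq_const.
        -- apply approach_lim.
        -- intros i. split; [exact Hxt|apply approach_in; lra].
    + apply (trace_eq (at_left y0) (approach c y0 y0) (fun y => J x y) (fun y => v x y));
        try assumption.
      * apply approach_at_left; lra.
      * intros i. apply HJ1. split; [exact Hxt|apply approach_in; lra].
      * apply (extension_seq v a b c y0 x y0 (fun _ => x)); try lra.
        -- apply (regular_uc _ _ _ Hr1 0 0). lia.
        -- apply is_lim_seq_const.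
        -- apply approach_lim.
        -- intros i. split; [exact Hxt|apply approach_in; lra].
  - apply expands_lin; apply expands_edge_x with eta; try assumption; try lra;
      intros t Ht; specialize (Hst t Ht); lra.
Qed.

(** * Relations between the limits at the cross point *)

Definition uD (P : cross_problem) (u : R -> R -> R) (p : idx) (m n : nat) : R :=
  extension (Omegap P p) (partial_derive m n u) (xi P) (zeta P).

Lemma expands_at_right (D : R -> R) (a b : R) (N : nat) :
  a < b -> uc_derivs (fun t => a < t < b) D N ->
  expands D a 1 N (fun n => @lim R_CompleteSpace (filtermap (Derive_n D n) (at_right a))).
Proof.
  intros Hab HD. apply (expands_uc_derivs D a b a 1 (b - a) N); try assumption; try lra.
  - intros n Hn. apply lim_at_right; [exact Hab|apply HD, Hn].
  - apply Rabs_R1.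
  - intros t Ht. lra.
Qed.

Lemma expands_at_left (D : R -> R) (a b : R) (N : nat) :
  a < b -> uc_derivs (fun t => a < t < b) D N ->
  expands D b (-1) N (fun n => @lim R_CompleteSpace (filtermap (Derive_n D n) (at_left b))).
Proof.
  intros Hab HD. apply (expands_uc_derivs D a b b (-1) (b - a) N); try assumption; try lra.
  - intros n Hn. apply lim_at_left; [exact Hab|apply HD, Hn].
  - rewrite Rabs_left; lra.
  - intros t Ht. lra.
Qed.

Lemma extension_dx (a b c d x y : R) (v : R -> R -> R) (k m n : nat) :
  a < b -> c < d -> a <= x <= b -> c <= y <= d ->
  regular (rect a b c d) v k -> (S (m + n) <= k)%nat ->
  extension (rect a b c d) (partial_derive m n (partial_derive 1 0 v)) x y
  = extension (rect a b c d) (partial_derive (S m) n v) x y.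
Proof.
  intros Hab Hcd Hx Hy Hr Hmn. apply extension_eq; try assumption.
  - apply Hr. lia.
  - intros s t H. apply (partial_derive_shift_x a b c d v k); [apply Hr|exact Hmn|exact H].
Qed.

Lemma extension_dy (a b c d x y : R) (v : R -> R -> R) (k m n : nat) :
  a < b -> c < d -> a <= x <= b -> c <= y <= d ->
  regular (rect a b c d) v k -> (S (m + n) <= k)%nat ->
  extension (rect a b c d) (partial_derive m n (partial_derive 0 1 v)) x y
  = extension (rect a b c d) (partial_derive m (S n) v) x y.
Proof.
  intros Hab Hcd Hx Hy Hr Hmn. apply extension_eq; try assumption.
  - apply Hr. lia.
  - intros s t H. rewrite partial_derive_shift_y, Nat.add_1_r. reflexivity.
Qed.

(** The first x-derivative plays the role of v and is regular to one order less, whence order six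
    for psi against seven for phi. *)
Lemma flux_jump_coeffs_x (a x0 b c d y0 s eta al be : R) (v J : R -> R -> R) (D : R -> R)
    (k : nat) (e : nat -> R) :
  a < x0 < b -> c < d -> c <= y0 <= d ->
  regular (rect x0 b c d) v (S k) -> regular (rect a x0 c d) v (S k) ->
  (forall x y, rect x0 b c d x y -> J x y = al * dx v x y) ->
  (forall x y, rect a x0 c d x y -> J x y = be * dx v x y) ->
  (forall y, c < y < d -> jump (fun x => J x y) x0 (D y)) ->
  Rabs s = 1 -> 0 < eta -> (forall t, 0 < t < eta -> c < y0 + s * t < d) ->
  expands D y0 s k e ->
  forall n, (n <= k)%nat ->
    al * extension (rect x0 b c d) (partial_derive 1 n v) x0 y0
    - be * extension (rect a x0 c d) (partial_derive 1 n v) x0 y0 = e n.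
Proof.
  intros Hx Hcd Hy Hr2 Hr1 HJ2 HJ1 Hj Hs Heta Hst He n Hn.
  rewrite <- (extension_dx x0 b c d x0 y0 v (S k) 0 n),
    <- (extension_dx a x0 c d x0 y0 v (S k) 0 n) by (assumption || lia || lra).
  apply (jump_coeffs_x a x0 b c d y0 s eta al be (partial_derive 1 0 v) J D k e);
    try assumption; apply regular_dx; assumption.
Qed.

Lemma flux_jump_coeffs_y (a b c y0 d x0 s eta al be : R) (v J : R -> R -> R) (D : R -> R)
    (k : nat) (e : nat -> R) :
  a < b -> a <= x0 <= b -> c < y0 < d ->
  regular (rect a b y0 d) v (S k) -> regular (rect a b c y0) v (S k) ->
  (forall x y, rect a b y0 d x y -> J x y = al * dy v x y) ->
  (forall x y, rect a b c y0 x y -> J x y = be * dy v x y) ->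
  (forall x, a < x < b -> jump (fun y => J x y) y0 (D x)) ->
  Rabs s = 1 -> 0 < eta -> (forall t, 0 < t < eta -> a < x0 + s * t < b) ->
  expands D x0 s k e ->
  forall m, (m <= k)%nat ->
    al * extension (rect a b y0 d) (partial_derive m 1 v) x0 y0
    - be * extension (rect a b c y0) (partial_derive m 1 v) x0 y0 = e m.
Proof.
  intros Hab Hx Hy Hr2 Hr1 HJ2 HJ1 Hj Hs Heta Hst He m Hm.
  rewrite <- (extension_dy a b y0 d x0 y0 v (S k) m 0),
    <- (extension_dy a b c y0 x0 y0 v (S k) m 0) by (assumption || lia || lra).
  apply (jump_coeffs_y a b c y0 d x0 s eta al be (partial_derive 0 1 v) J D k e);
    try assumption; apply regular_dy; assumption.
Qed.

(** * Quadrants as rectangles and the relations at the corner *)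

Definition xlo (P : cross_problem) (p : idx) : R :=
  match p with p1 | p4 => l1 P | p2 | p3 => xi P end.
Definition xhi (P : cross_problem) (p : idx) : R :=
  match p with p1 | p4 => xi P | p2 | p3 => l2 P end.
Definition ylo (P : cross_problem) (p : idx) : R :=
  match p with p1 | p2 => zeta P | p3 | p4 => l3 P end.
Definition yhi (P : cross_problem) (p : idx) : R :=
  match p with p1 | p2 => l4 P | p3 | p4 => zeta P end.

Lemma Omegap_rect (P : cross_problem) (p : idx) :
  Omegap P p = rect (xlo P p) (xhi P p) (ylo P p) (yhi P p).
Proof. destruct p; reflexivity. Qed.

Lemma quadrant_bounds (P : cross_problem) (p : idx) :
  Omega P (xi P) (zeta P) ->
  xlo P p < xhi P p /\ ylo P p < yhi P p /\
  xlo P p <= xi P <= xhi P p /\ ylo P p <= zeta P <= yhi P p.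
Proof. intros [Hx Hy]. destruct p; simpl; lra. Qed.

Lemma quadrant_off_interface (P : cross_problem) (p : idx) (x y : R) :
  Omega P (xi P) (zeta P) -> Omegap P p x y -> Omega P x y /\ ~ Gamma P x y.
Proof.
  intros [Hx Hy] H. split.
  - split; destruct p; simpl in H; lra.
  - intros [[q Hq] | [Hq1 Hq2]].
    + destruct p, q; simpl in *; lra.
    + destruct p; simpl in *; lra.
Qed.

(** The coefficient is constant around each point of an open quadrant, hence leaves the
    divergence. *)
Lemma source_in_quadrant (P : cross_problem) (u : R -> R -> R) (p : idx) (x y : R) :
  Omega P (xi P) (zeta P) ->
  (forall p x y, Omegap P p x y -> coef P x y = a P p) ->
  exact_solution P u -> Omegap P p x y ->
  f P x y = - (a P p * (partial_derive 2 0 u x y + partial_derive 0 2 u x y)).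
Proof.
  intros hcross hcoef [Hpde _] H.
  destruct (quadrant_off_interface P p x y hcross H) as [HO HG].
  rewrite <- (Hpde x y HO HG). f_equal. rewrite Rmult_plus_distr_l.
  assert (HA : rect (xlo P p) (xhi P p) (ylo P p) (yhi P p) x y)
    by (rewrite <- Omegap_rect; exact H).
  f_equal.
  - change (partial_derive 2 0 u x y) with (Derive (fun s => dx u s y) x).
    rewrite <- Derive_scal.
    apply (rect_row_ext _ _ _ _ x y _ _ 1) with (2 := HA).
    intros s Hs. rewrite <- Omegap_rect in Hs. rewrite (hcoef p s y Hs). reflexivity.
  - change (partial_derive 0 2 u x y) with (Derive (fun t => dy u x t) y).
    rewrite <- Derive_scal.
    apply (rect_col_ext _ _ _ _ x y _ _ 1) with (2 := HA).
    intros t Ht. rewrite <- Omegap_rect in Ht. rewrite (hcoef p x t Ht). reflexivity.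
Qed.

(** The differentiated equation is an identity between uniformly continuous functions on the open
    quadrant, so it passes to the corner. *)
Lemma corner_pde (P : cross_problem) (u : R -> R -> R) (p : idx) (m n : nat) :
  Omega P (xi P) (zeta P) -> 0 < a P p ->
  (forall p x y, Omegap P p x y -> coef P x y = a P p) ->
  exact_solution P u -> regular (Omegap P p) u 7 -> uc_partials (Omegap P p) (f P) 5 ->
  (m + n <= 5)%nat ->
  uD P u p (S (S m)) n + uD P u p m (S (S n)) = - (fD P p m n / a P p).
Proof.
  intros hcross Hap hcoef hu Hr [_ Hf] Hmn.
  pose proof (fun x y => source_in_quadrant P u p x y hcross hcoef hu) as Hsrc.
  unfold uD, fD. specialize (Hf m n Hmn).
  destruct (quadrant_bounds P p hcross) as [Hab [Hcd [Hx Hy]]].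
  rewrite Omegap_rect in *.
  rewrite (extension_comb (partial_derive (S (S m)) n u) (partial_derive m (S (S n)) u)
    (partial_derive m n (f P)) (- a P p) (- a P p)); try assumption.
  - field. lra.
  - apply Hr. lia.
  - apply Hr. lia.
  - intros s t H. erewrite (partial_derive_laplacian _ _ _ _ (a P p) u (f P) 5);
      [ring|apply Hr|exact Hsrc|exact Hmn|exact H].
Qed.

(** [Gamma_3], [Gamma_1] and [Gamma_4] join the quadrants in the chain 3, 2, 1, 4, along which
    everything is expressed through u_2. *)
Definition corner_jump_relations (P : cross_problem) (u : R -> R -> R) : Prop :=
  (forall n, (n <= 7)%nat -> uD P u p2 0 n - uD P u p1 0 n = phiD P p1 n) /\
  (forall n, (n <= 6)%nat -> a P p2 * uD P u p2 1 n - a P p1 * uD P u p1 1 n = psiD P p1 n) /\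
  (forall m, (m <= 7)%nat -> uD P u p2 m 0 - uD P u p3 m 0 = phiD P p3 m) /\
  (forall m, (m <= 6)%nat -> a P p2 * uD P u p2 m 1 - a P p3 * uD P u p3 m 1 = psiD P p3 m) /\
  (forall m, (m <= 7)%nat -> uD P u p1 m 0 - uD P u p4 m 0 = phiD P p4 m) /\
  (forall m, (m <= 6)%nat -> a P p1 * uD P u p1 m 1 - a P p4 * uD P u p4 m 1 = psiD P p4 m).

Lemma corner_jumps (P : cross_problem) (u : R -> R -> R) :
  Omega P (xi P) (zeta P) ->
  (forall p x y, Omegap P p x y -> coef P x y = a P p) ->
  exact_solution P u -> (forall p, regular (Omegap P p) u 7) ->
  (forall p, uc_derivs (branch P p) (phi P p) 7) ->
  (forall p, uc_derivs (branch P p) (psi P p) 6) ->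
  corner_jump_relations P u.
Proof.
  intros [Hx Hy] hcoef [_ [Hj _]] Hr Hphi Hpsi.
  assert (H11 : Rabs 1 = 1) by apply Rabs_R1.
  assert (H12 : Rabs (-1) = 1) by (rewrite Rabs_left; lra).
  assert (HJx : forall p x y, Omegap P p x y -> coef P x y * dx u x y = a P p * dx u x y)
    by (intros p x y H; rewrite (hcoef p) by exact H; reflexivity).
  assert (HJy : forall p x y, Omegap P p x y -> coef P x y * dy u x y = a P p * dy u x y)
    by (intros p x y H; rewrite (hcoef p) by exact H; reflexivity).
  refine (conj _ (conj _ (conj _ (conj _ (conj _ _))))).
  - intros n Hn. rewrite <- (Rmult_1_l (uD P u p2 0 n)), <- (Rmult_1_l (uD P u p1 0 n)).
    apply (jump_coeffs_x (l1 P) (xi P) (l2 P) (zeta P) (l4 P) (zeta P) 1 (l4 P - zeta P) 1 1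
      u u (phi P p1) 7 (phiD P p1)); try lra; try lia; try exact (Hr p2); try exact (Hr p1).
    + intros; ring.
    + intros; ring.
    + intros y Hyy. apply (Hj p1 (xi P) y (conj eq_refl Hyy)).
    + intros; lra.
    + apply expands_at_right with (l4 P); [lra|exact (Hphi p1)].
  - intros n Hn.
    apply (flux_jump_coeffs_x (l1 P) (xi P) (l2 P) (zeta P) (l4 P) (zeta P) 1 (l4 P - zeta P)
      (a P p2) (a P p1) u (fun x y => coef P x y * dx u x y) (psi P p1) 6 (psiD P p1));
      try lra; try lia; try exact (Hr p2); try exact (Hr p1);
      try exact (HJx p2); try exact (HJx p1).
    + intros y Hyy. apply (Hj p1 (xi P) y (conj eq_refl Hyy)).
    + intros; lra.
    + apply expands_at_right with (l4 P); [lra|exact (Hpsi p1)].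
  - intros m Hm. rewrite <- (Rmult_1_l (uD P u p2 m 0)), <- (Rmult_1_l (uD P u p3 m 0)).
    apply (jump_coeffs_y (xi P) (l2 P) (l3 P) (zeta P) (l4 P) (xi P) 1 (l2 P - xi P) 1 1
      u u (phi P p3) 7 (phiD P p3)); try lra; try lia; try exact (Hr p2); try exact (Hr p3).
    + intros; ring.
    + intros; ring.
    + intros x Hxx. apply (Hj p3 x (zeta P) (conj Hxx eq_refl)).
    + intros; lra.
    + apply expands_at_right with (l2 P); [lra|exact (Hphi p3)].
  - intros m Hm.
    apply (flux_jump_coeffs_y (xi P) (l2 P) (l3 P) (zeta P) (l4 P) (xi P) 1 (l2 P - xi P)
      (a P p2) (a P p3) u (fun x y => coef P x y * dy u x y) (psi P p3) 6 (psiD P p3));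
      try lra; try lia; try exact (Hr p2); try exact (Hr p3);
      try exact (HJy p2); try exact (HJy p3).
    + intros x Hxx. apply (Hj p3 x (zeta P) (conj Hxx eq_refl)).
    + intros; lra.
    + apply expands_at_right with (l2 P); [lra|exact (Hpsi p3)].
  - intros m Hm. rewrite <- (Rmult_1_l (uD P u p1 m 0)), <- (Rmult_1_l (uD P u p4 m 0)).
    (* [Gamma_4] reaches the cross point from the left: direction -1 and left limits. *)
    apply (jump_coeffs_y (l1 P) (xi P) (l3 P) (zeta P) (l4 P) (xi P) (-1) (xi P - l1 P) 1 1
      u u (phi P p4) 7 (phiD P p4)); try lra; try lia; try exact (Hr p1); try exact (Hr p4).
    + intros; ring.
    + intros; ring.
    + intros x Hxx. apply (Hj p4 x (zeta P) (conj Hxx eq_refl)).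
    + intros; lra.
    + apply expands_at_left with (l1 P); [lra|exact (Hphi p4)].
  - intros m Hm.
    apply (flux_jump_coeffs_y (l1 P) (xi P) (l3 P) (zeta P) (l4 P) (xi P) (-1) (xi P - l1 P)
      (a P p1) (a P p4) u (fun x y => coef P x y * dy u x y) (psi P p4) 6 (psiD P p4));
      try lra; try lia; try exact (Hr p1); try exact (Hr p4);
      try exact (HJy p1); try exact (HJy p4).
    + intros x Hxx. apply (Hj p4 x (zeta P) (conj Hxx eq_refl)).
    + intros; lra.
    + apply expands_at_left with (l1 P); [lra|exact (Hpsi p4)].
Qed.

(** * Reduction by the differential equation *)

Lemma Rsum_ext {I : Type} (s : list I) (f g : I -> R) :
  (forall i, In i s -> f i = g i) -> Rsum s f = Rsum s g.
Proof.
  unfold Rsum. intros H. f_equal. apply map_ext_in. exact H.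
Qed.

Lemma Rsum_plus {I : Type} (s : list I) (f g : I -> R) :
  Rsum s (fun i => f i + g i) = Rsum s f + Rsum s g.
Proof. unfold Rsum. induction s as [|i s IH]; simpl; [ring|]. rewrite IH. ring. Qed.

Lemma Rsum_scal {I : Type} (s : list I) (r : R) (f : I -> R) :
  Rsum s (fun i => r * f i) = r * Rsum s f.
Proof. unfold Rsum. induction s as [|i s IH]; simpl; [ring|]. rewrite IH. ring. Qed.

Lemma Rsum_exchange {I J : Type} (s : list I) (t : list J) (c : I -> R) (w : J -> R)
    (g : J -> I -> R) :
  Rsum s (fun i => c i * Rsum t (fun j => w j * g j i))
  = Rsum t (fun j => w j * Rsum s (fun i => c i * g j i)).
Proof.
  induction s as [|i s IH].
  - unfold Rsum at 1. simpl. induction t as [|j t IHt]; [reflexivity|].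
    unfold Rsum in *. simpl in *. rewrite <- IHt. ring.
  - change (Rsum (i :: s) (fun i => c i * Rsum t (fun j => w j * g j i)))
      with (c i * Rsum t (fun j => w j * g j i)
            + Rsum s (fun i => c i * Rsum t (fun j => w j * g j i))).
    rewrite IH, <- Rsum_scal, <- Rsum_plus. apply Rsum_ext. intros j _.
    unfold Rsum. simpl. ring.
Qed.

Lemma G_mono (m n : nat) (x y : R) :
  G m n x y = Rsum (seq 0 (n / 2 + 1)) (fun l =>
    (-1) ^ l * (mono x (m + 2 * l) * mono y (n - 2 * l))).
Proof.
  apply Rsum_ext. intros l _. unfold mono, Rdiv. rewrite Rinv_mult. ring.
Qed.

Lemma H_mono (m n : nat) (x y : R) :
  H m n x y = Rsum (seq 1 (1 + n / 2)) (fun l =>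
    (-1) ^ l * (mono x (m + 2 * l) * mono y (n + 2 - 2 * l))).
Proof.
  apply Rsum_ext. intros l _. unfold mono, Rdiv. rewrite Rinv_mult. ring.
Qed.

(** All index sets are finite and explicit, so the summation identities become polynomial identities
    for [ring]. *)
Ltac expand_sums :=
  let L1 := eval vm_compute in (Lambda1 7) in
  let L5 := eval vm_compute in (Lambda 5) in
  change (Lambda1 7) with L1; change (Lambda 5) with L5;
  cbv [Rsum map fold_right seq taylor_poly2 taylor_poly sum_f_R0
       Nat.div Nat.divmod Nat.modulo Nat.sub Nat.add Nat.mul fst snd].

(** For m <= 1 the polynomial G m n is harmonic, and x^m y^n / (m! n!) is its only term of x-degree
    below two. H m n has no such term, and minus its Laplacian is x^m y^n / (m! n!). *)
Lemma harmonic_reduction (w F : nat -> nat -> R) (x y : R) :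
  (forall m n, (m + n <= 5)%nat -> w (S (S m)) n + w m (S (S n)) = - F m n) ->
  taylor_poly2 w 7 x y
  = Rsum (Lambda1 7) (fun '(m, n) => w m n * G m n x y)
    + Rsum (Lambda 5) (fun '(m, n) => F m n * H m n x y).
Proof.
  intros Hw.
  assert (Hw' : forall m n, (m + n <= 5)%nat -> w (S (S m)) n = - F m n - w m (S (S n)))
    by (intros m n Hmn; specialize (Hw m n Hmn); lra).
  expand_sums. rewrite !G_mono, !H_mono. expand_sums.
  rewrite !Hw' by lia. ring.
Qed.

Lemma taylor_poly2_transpose (w : nat -> nat -> R) (x y : R) :
  taylor_poly2 w 7 x y = taylor_poly2 (fun m n => w n m) 7 y x.
Proof. expand_sums. ring. Qed.

Lemma Rsum_Lambda5_transpose (v : nat -> nat -> R) :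
  Rsum (Lambda 5) (fun '(m, n) => v m n) = Rsum (Lambda 5) (fun '(m, n) => v n m).
Proof. expand_sums. ring. Qed.

(** The version for quadrants 3 and 4, where the y-order is lowered to match the conditions on the
    horizontal interfaces. *)
Lemma harmonic_reduction_transposed (w F : nat -> nat -> R) (x y : R) :
  (forall m n, (m + n <= 5)%nat -> w (S (S m)) n + w m (S (S n)) = - F m n) ->
  taylor_poly2 w 7 x y
  = Rsum (Lambda1 7) (fun '(n, m) => w m n * G n m y x)
    + Rsum (Lambda 5) (fun '(m, n) => F m n * H n m y x).
Proof.
  intros Hw.
  rewrite taylor_poly2_transpose, (harmonic_reduction _ (fun m n => F n m)).
  - f_equal. apply (Rsum_Lambda5_transpose (fun m n => F n m * H m n y x)).
  - intros m n Hmn. rewrite <- (Hw n m) by lia. ring.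
Qed.

(** * Elimination of the interface unknowns *)

(** Companion of [G1], [G3], [G4] for quadrant 2. It multiplies only limits of u_2 and so enters
    [residual] but not [rhs]. *)
Definition G2 (C : Z -> Z -> R) (h : R) (m n : nat) : R :=
  Rsum [0; 1]%Z (fun k => Rsum [0; 1]%Z (fun l => C k l * G m n (IZR k * h) (IZR l * h))).

(* The coefficient of [uD P u p2 m n], m <= 1, once all four quadrants have been reduced to
   the second one.  The equation carries [G3] and [G4] at (m', n'), n' <= 1, only to
   (m, n) = (m' mod 2, n' + 2 (m' / 2)), which inverts to n' = n mod 2, m' = m + 2 (n / 2). *)
Definition residual (P : cross_problem) (C : Z -> Z -> R) (h : R) (m n : nat) : R :=
  G2 C h m n + (a P p2 / a P p1) ^ m * G1 C h m n
  + (-1) ^ (n / 2) *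
    ((a P p2 / a P p3) ^ (n mod 2) * G3 C h (m + 2 * (n / 2)) (n mod 2)
     + (a P p1 / a P p4) ^ (n mod 2) * (a P p2 / a P p1) ^ m
       * G4 C h (m + 2 * (n / 2)) (n mod 2)).

(** Up to the factor h^(m+n) these are rational identities in the four a_p, verified one by one;
    positivity clears the denominators. *)
Lemma stencil_residual (P : cross_problem) (h : R) (m n : nat) :
  (forall p, 0 < a P p) -> (m <= 1)%nat -> (m + n <= 7)%nat ->
  residual P (stencil P) h m n = 0.
Proof.
  intros ha Hm Hmn.
  pose proof (ha p1). pose proof (ha p2). pose proof (ha p3). pose proof (ha p4).
  unfold residual, G1, G2, G3, G4, G.
  set (a1 := a P p1) in *. set (a2 := a P p2) in *.
  set (a3 := a P p3) in *. set (a4 := a P p4) in *.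
  destruct m as [|[|m]]; [| |lia];
  (* The enumeration also meets (1, 7). The identity holds there too: G 1 7 is a multiple of the
     imaginary part of (x + i y)^8, which vanishes on the axes and diagonals, hence at all nodes. *)
  (do 8 (destruct n as [|n];
    [cbv [Rsum map fold_right seq stencil Nat.div Nat.divmod Nat.modulo Nat.sub Nat.add Nat.mul fst snd];
     fold a1 a2 a3 a4;
     repeat match goal with |- context [INR (fact ?k)] =>
       let v := eval vm_compute in (Z.of_nat (fact k)) in
       replace (INR (fact k)) with (IZR v) by (rewrite INR_IZR_INZ; reflexivity) end;
     cbv [pow]; field; repeat split; lra|]); lia).
Qed.

Definition corner_pde_relations (P : cross_problem) (u : R -> R -> R) : Prop :=
  forall p m n, (m + n <= 5)%nat ->
    uD P u p (S (S m)) n + uD P u p m (S (S n)) = - (fD P p m n / a P p).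

(** An even x-order m of u_1 ends at (0, m + n) and an odd one at (1, m + n - 1), with sign
    (-1)^(m/2). This explains the parity factors and the derivative orders in [Phi1] and [Psi1]. *)
Lemma interface_elimination (P : cross_problem) (u : R -> R -> R) (C : Z -> Z -> R) (h : R) :
  (forall p, 0 < a P p) -> corner_pde_relations P u -> corner_jump_relations P u ->
  Rsum (Lambda1 7) (fun '(m, n) => uD P u p1 m n * G1 C h m n)
  + Rsum (Lambda1 7) (fun '(m, n) => uD P u p2 m n * G2 C h m n)
  + Rsum (Lambda1 7) (fun '(n, m) => uD P u p3 m n * G3 C h m n)
  + Rsum (Lambda1 7) (fun '(n, m) => uD P u p4 m n * G4 C h m n)
  = Rsum (Lambda1 7) (fun '(m, n) => uD P u p2 m n * residual P C h m n)
    + (Rsum (Lambda1 7) (fun '(n, m) => F1 P C h m n)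
       + Rsum (Lambda1 7) (fun '(n, m) => Phi1 P C h m n)
       + Rsum (seq 0 8) (fun m => Phi P C h m)
       + Rsum (Lambda1 7) (fun '(n, m) => Psi1 P C h m n)
       + Rsum (seq 0 7) (fun m => Psi P C h m)).
Proof.
  intros ha Hpde (J1 & K1 & J3 & K3 & J4 & K4).
  assert (E : forall p m n, (m + n <= 5)%nat -> uD P u p (S (S m)) n
    = - (fD P p m n * / a P p) - uD P u p m (S (S n))).
  { intros p m n Hmn. specialize (Hpde p m n Hmn). unfold Rdiv in Hpde. lra. }
  assert (J1' : forall n, (n <= 7)%nat -> uD P u p1 0 n = uD P u p2 0 n - phiD P p1 n)
    by (intros n Hn; rewrite <- J1 by exact Hn; ring).
  assert (J3' : forall n, (n <= 7)%nat -> uD P u p3 n 0 = uD P u p2 n 0 - phiD P p3 n)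
    by (intros n Hn; rewrite <- J3 by exact Hn; ring).
  assert (J4' : forall n, (n <= 7)%nat -> uD P u p4 n 0 = uD P u p1 n 0 - phiD P p4 n)
    by (intros n Hn; rewrite <- J4 by exact Hn; ring).
  pose proof (ha p1) as Ha1. pose proof (ha p3) as Ha3. pose proof (ha p4) as Ha4.
  assert (K1' : forall n, (n <= 6)%nat ->
    uD P u p1 1 n = (a P p2 * uD P u p2 1 n - psiD P p1 n) * / a P p1)
    by (intros n Hn; rewrite <- K1 by exact Hn; field; lra).
  assert (K3' : forall n, (n <= 6)%nat ->
    uD P u p3 n 1 = (a P p2 * uD P u p2 n 1 - psiD P p3 n) * / a P p3)
    by (intros n Hn; rewrite <- K3 by exact Hn; field; lra).
  assert (K4' : forall n, (n <= 6)%nat ->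
    uD P u p4 n 1 = (a P p1 * uD P u p1 n 1 - psiD P p4 n) * / a P p4)
    by (intros n Hn; rewrite <- K4 by exact Hn; field; lra).
  (* From here each inverse of a_p is an atom: both sides carry the same products a_p * / a_p, and
     nothing has to be cancelled. *)
  clear Hpde J1 J3 J4 K1 K3 K4 ha Ha1 Ha3 Ha4.
  unfold F1, Phi1, Phi, Psi1, Psi, residual.
  generalize (G1 C h) (G2 C h) (G3 C h) (G4 C h). intros g1 g2 g3 g4.
  expand_sums. cbv [odd Nat.odd Nat.even negb]. unfold Rdiv.
  (* The order matters: u_3 and u_4 become u_2 and u_1 of high x-order, the equation lowers that
     order to at most one, and only then do the conditions on [Gamma_1] apply. *)
  rewrite ?J3', ?J4', ?K3', ?K4' by lia.
  rewrite ?E by lia. rewrite ?J1', ?K1' by lia.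
  ring.
Qed.

(** * Consistency *)

Definition quadrant_nodes (p : idx) : list (Z * Z) :=
  match p with
  | p1 => [(-1, 0); (-1, 1)]%Z
  | p2 => [(0, 0); (0, 1); (1, 0); (1, 1)]%Z
  | p3 => [(0, -1); (1, -1)]%Z
  | p4 => [(-1, -1)]%Z
  end.

Lemma Lh_quadrants (C : Z -> Z -> R) (w : idx -> Z -> Z -> R) :
  Lh C (fun k l => w (node_piece k l) k l)
  = Rsum [p1; p2; p3; p4] (fun p => Rsum (quadrant_nodes p) (fun q =>
      C (fst q) (snd q) * w p (fst q) (snd q))).
Proof. cbv [Lh Rsum map fold_right quadrant_nodes fst snd node_piece Z.leb Z.compare]. ring. Qed.

Lemma Rsum_two_reductions {I J : Type} (s : list J) (L M : list I) (c t : J -> R)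
    (w v : I -> R) (g e : I -> J -> R) :
  (forall q, In q s -> t q = Rsum L (fun i => w i * g i q) + Rsum M (fun i => v i * e i q)) ->
  Rsum s (fun q => c q * t q)
  = Rsum L (fun i => w i * Rsum s (fun q => c q * g i q))
    + Rsum M (fun i => v i * Rsum s (fun q => c q * e i q)).
Proof.
  intros Ht. rewrite <- (Rsum_exchange s L c w g), <- (Rsum_exchange s M c v e), <- Rsum_plus. apply Rsum_ext.
  intros q Hq. rewrite Ht by exact Hq. ring.
Qed.

Ltac nodes_match h :=
  intros [? ?] _;
  cbv [G1 G2 G3 G4 Hp Rsum map fold_right quadrant_nodes fst snd];
  replace (-1 * h) with (- h) by ring; ring.

(** Exchanging the sums over nodes and over derivative orders turns the node sums of G and H into
    the weights of the scheme. *)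
Lemma quadrant_contributions (P : cross_problem) (u : R -> R -> R) (C : Z -> Z -> R) (h : R) :
  corner_pde_relations P u ->
  Lh C (fun k l => taylor_poly2 (uD P u (node_piece k l)) 7 (IZR k * h) (IZR l * h))
  = Rsum (Lambda1 7) (fun '(m, n) => uD P u p1 m n * G1 C h m n)
    + Rsum (Lambda1 7) (fun '(m, n) => uD P u p2 m n * G2 C h m n)
    + Rsum (Lambda1 7) (fun '(n, m) => uD P u p3 m n * G3 C h m n)
    + Rsum (Lambda1 7) (fun '(n, m) => uD P u p4 m n * G4 C h m n)
    + Rsum (Lambda 5) (fun '(m, n) => F0 P C h m n).
Proof.
  intros Hpde.
  assert (Hx : forall p, Rsum (quadrant_nodes p) (fun q => C (fst q) (snd q)
      * taylor_poly2 (uD P u p) 7 (IZR (fst q) * h) (IZR (snd q) * h))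
    = Rsum (Lambda1 7) (fun i => uD P u p (fst i) (snd i) * Rsum (quadrant_nodes p) (fun q =>
        C (fst q) (snd q) * G (fst i) (snd i) (IZR (fst q) * h) (IZR (snd q) * h)))
      + Rsum (Lambda 5) (fun i => fD P p (fst i) (snd i) / a P p * Rsum (quadrant_nodes p) (fun q =>
        C (fst q) (snd q) * H (fst i) (snd i) (IZR (fst q) * h) (IZR (snd q) * h)))).
  { intros p. apply Rsum_two_reductions. intros q _.
    rewrite (harmonic_reduction _ _ _ _ (Hpde p)).
    f_equal; apply Rsum_ext; intros [m n] _; reflexivity. }
  assert (Hy : forall p, Rsum (quadrant_nodes p) (fun q => C (fst q) (snd q)
      * taylor_poly2 (uD P u p) 7 (IZR (fst q) * h) (IZR (snd q) * h))
    = Rsum (Lambda1 7) (fun i => uD P u p (snd i) (fst i) * Rsum (quadrant_nodes p) (fun q =>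
        C (fst q) (snd q) * G (fst i) (snd i) (IZR (snd q) * h) (IZR (fst q) * h)))
      + Rsum (Lambda 5) (fun i => fD P p (fst i) (snd i) / a P p * Rsum (quadrant_nodes p) (fun q =>
        C (fst q) (snd q) * H (snd i) (fst i) (IZR (snd q) * h) (IZR (fst q) * h)))).
  { intros p. apply Rsum_two_reductions. intros q _.
    rewrite (harmonic_reduction_transposed _ _ _ _ (Hpde p)).
    f_equal; apply Rsum_ext; intros [m n] _; reflexivity. }
  rewrite (Lh_quadrants C (fun p k l =>
    taylor_poly2 (uD P u p) 7 (IZR k * h) (IZR l * h))).
  transitivity
    (Rsum (Lambda1 7) (fun '(m, n) => uD P u p1 m n * G1 C h m n)
    + Rsum (Lambda1 7) (fun '(m, n) => uD P u p2 m n * G2 C h m n)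
    + Rsum (Lambda1 7) (fun '(n, m) => uD P u p3 m n * G3 C h m n)
    + Rsum (Lambda1 7) (fun '(n, m) => uD P u p4 m n * G4 C h m n)
    + (Rsum (Lambda 5) (fun '(m, n) => fD P p1 m n / a P p1 * Hp C h p1 m n)
    + Rsum (Lambda 5) (fun '(m, n) => fD P p2 m n / a P p2 * Hp C h p2 m n)
    + Rsum (Lambda 5) (fun '(m, n) => fD P p3 m n / a P p3 * Hp C h p3 m n)
    + Rsum (Lambda 5) (fun '(m, n) => fD P p4 m n / a P p4 * Hp C h p4 m n))).
  - unfold Rsum at 1. cbn [map fold_right].
    rewrite (Hx p1), (Hx p2), (Hy p3), (Hy p4). clear Hx Hy Hpde.
    (* A template for regrouping, so that the eight sums are matched one at a time. *)
    assert (Hr : forall A1 A2 A3 A4 B1 B2 B3 B4 A1' A2' A3' A4' B1' B2' B3' B4' : R,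
      A1 = A1' -> A2 = A2' -> A3 = A3' -> A4 = A4' ->
      B1 = B1' -> B2 = B2' -> B3 = B3' -> B4 = B4' ->
      A1 + B1 + (A2 + B2 + (A3 + B3 + (A4 + B4 + 0)))
      = A1' + A2' + A3' + A4' + (B1' + B2' + B3' + B4')) by (intros; subst; ring).
    apply Hr; apply Rsum_ext; nodes_match h.
  - f_equal. rewrite <- !Rsum_plus. apply Rsum_ext. intros [m n] _.
    cbv [F0 Rsum map fold_right]. ring.
Qed.

(** Exact in h: on the Taylor polynomials the scheme has no error, so the consistency error is the
    Taylor remainder alone. *)
Lemma Lh_taylor (P : cross_problem) (u : R -> R -> R) (h : R) :
  (forall p, 0 < a P p) -> corner_pde_relations P u -> corner_jump_relations P u ->
  Lh (stencil P) (fun k l => taylor_poly2 (uD P u (node_piece k l)) 7 (IZR k * h) (IZR l * h))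
  = rhs P (stencil P) h.
Proof.
  intros ha Hpde Hjump.
  rewrite quadrant_contributions, interface_elimination by assumption.
  (* Written as a product so that [Rsum_scal] can pull out a zero factor. *)
  rewrite (Rsum_ext (Lambda1 7) _ (fun _ => 0 * 0)).
  - rewrite Rsum_scal. unfold rhs. ring.
  - intros [m n] Hmn. unfold Lambda1, Lambda in Hmn.
    apply filter_In in Hmn as [Hmn Hm]. apply filter_In in Hmn as [_ Hmn].
    apply Nat.leb_le in Hm, Hmn. simpl in Hm, Hmn.
    rewrite stencil_residual by assumption. ring.
Qed.

(** * Error bounds at the nodes *)

Lemma Rsum_abs_le {I : Type} (s : list I) (f g : I -> R) :
  (forall i, In i s -> Rabs (f i) <= g i) -> Rabs (Rsum s f) <= Rsum s g.
Proof.
  unfold Rsum. induction s as [|i s IH]; intros Hfg; simpl.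
  - rewrite Rabs_R0. lra.
  - eapply Rle_trans; [apply Rabs_triang|]. apply Rplus_le_compat.
    + apply Hfg. simpl. auto.
    + apply IH. intros j Hj. apply Hfg. simpl. auto.
Qed.

Lemma Lh_diff_bound (C w v : Z -> Z -> R) (r : R) :
  (forall k l, (-1 <= k <= 1)%Z -> (-1 <= l <= 1)%Z -> Rabs (w k l - v k l) <= r) ->
  Rabs (Lh C w - Lh C v) <= Lh (fun k l => Rabs (C k l)) (fun _ _ => r).
Proof.
  intros Hwv. unfold Lh.
  replace (_ - _) with (Rsum [-1; 0; 1]%Z (fun k => Rsum [-1; 0; 1]%Z (fun l =>
    C k l * (w k l - v k l)))) by (cbv [Rsum map fold_right]; ring).
  apply Rsum_abs_le. intros k Hk. apply Rsum_abs_le. intros l Hl.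
  rewrite Rabs_mult. apply Rmult_le_compat_l; [apply Rabs_pos|].
  simpl in Hk, Hl. apply Hwv; lia.
Qed.

Lemma node_value_taylor (P : cross_problem) (u : R -> R -> R) (p : idx) :
  Omega P (xi P) (zeta P) -> regular (Omegap P p) u 7 ->
  exists K, 0 <= K /\ forall h k l, node_piece k l = p ->
    (-1 <= k <= 1)%Z -> (-1 <= l <= 1)%Z -> 0 <= h ->
    h <= xi P - l1 P -> h <= l2 P - xi P -> h <= zeta P - l3 P -> h <= l4 P - zeta P ->
    Rabs (node_value P u h k l - taylor_poly2 (uD P u p) 7 (IZR k * h) (IZR l * h))
    <= K * h ^ 8.
Proof.
  intros hcross Hr. destruct (quadrant_bounds P p hcross) as [Hab [Hcd [Hx Hy]]].
  assert (Hr' := Hr). rewrite Omegap_rect in Hr'.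
  destruct (taylor_closure _ _ _ _ u 7 Hab Hcd Hr') as [K [HK H]].
  (* The two increments to a node add up to at most 2 h. *)
  exists (K * 2 ^ 8). split; [nra|].
  intros h k l Hp Hk Hl Hh H1 H2 H3 H4. unfold node_value, uD. rewrite Hp, Omegap_rect.
  assert (Hkl : xlo P p <= xi P + IZR k * h <= xhi P p
    /\ ylo P p <= zeta P + IZR l * h <= yhi P p).
  { assert (Hk3 : k = (-1)%Z \/ k = 0%Z \/ k = 1%Z) by lia.
    assert (Hl3 : l = (-1)%Z \/ l = 0%Z \/ l = 1%Z) by lia.
    subst p. destruct Hk3 as [-> | [-> | ->]], Hl3 as [-> | [-> | ->]]; simpl; lra. }
  destruct Hkl as [Hkx Hly].
  specialize (H (xi P) (zeta P) _ _ Hx Hy Hkx Hly).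
  replace (xi P + IZR k * h - xi P) with (IZR k * h) in H by ring.
  replace (zeta P + IZR l * h - zeta P) with (IZR l * h) in H by ring.
  eapply Rle_trans; [exact H|]. rewrite Rmult_assoc, <- Rpow_mult_distr.
  apply Rmult_le_compat_l; [exact HK|]. apply pow_incr. split.
  - pose proof (Rabs_pos (IZR k * h)). pose proof (Rabs_pos (IZR l * h)). lra.
  - assert (Hb : forall j, (-1 <= j <= 1)%Z -> Rabs (IZR j * h) <= h).
    { intros j [Hj1 Hj2]. apply IZR_le in Hj1, Hj2. apply Rabs_le. nra. }
    pose proof (Hb k Hk). pose proof (Hb l Hl). lra.
Qed.

Theorem theorem2p3 (P : cross_problem) (u : R -> R -> R)
  (hx : l1 P < l2 P) (hy : l3 P < l4 P)
  (hN0 : (0 < N0 P)%nat) (hsides : l4 P - l3 P = INR (N0 P) * (l2 P - l1 P))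
  (hcross : Omega P (xi P) (zeta P))
  (ha : forall p, 0 < a P p)
  (hcoef : forall p x y, Omegap P p x y -> coef P x y = a P p)
  (hu : exact_solution P u)
  (hu_reg : forall p, uc_partials (Omegap P p) u 7)
  (hu_lip : forall p m n, (m + n = 7)%nat ->
     lipschitz_on (Omegap P p) (partial_derive m n u))
  (hf_reg : forall p, uc_partials (Omegap P p) (f P) 5)
  (hphi_reg : forall p, uc_derivs (branch P p) (phi P p) 7)
  (hpsi_reg : forall p, uc_derivs (branch P p) (psi P p) 6) :
  consistency_order P u (stencil P) (rhs P (stencil P)) 7.
Proof.
  assert (Hr : forall p, regular (Omegap P p) u 7).
  { intros p. constructor; [apply hu_reg|apply hu_reg|apply hu_lip]. }
  assert (Hpde : corner_pde_relations P u) by (intros p m n; apply corner_pde; auto).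
  assert (Hjump : corner_jump_relations P u) by (apply corner_jumps; assumption).
  destruct (node_value_taylor P u p1 hcross (Hr p1)) as [K1 [HK1 H1]].
  destruct (node_value_taylor P u p2 hcross (Hr p2)) as [K2 [HK2 H2]].
  destruct (node_value_taylor P u p3 hcross (Hr p3)) as [K3 [HK3 H3]].
  destruct (node_value_taylor P u p4 hcross (Hr p4)) as [K4 [HK4 H4]].
  set (K := K1 + K2 + K3 + K4).
  destruct hcross as [[Hx1 Hx2] [Hy1 Hy2]].
  (* The distance from the cross point to the boundary; below it every node lies in the closure of
     its quadrant. *)
  set (h0 := Rmin (Rmin (xi P - l1 P) (l2 P - xi P)) (Rmin (zeta P - l3 P) (l4 P - zeta P))).
  exists (Lh (fun k l => Rabs (stencil P k l)) (fun _ _ => K)), h0. split.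
  { unfold h0. repeat apply Rmin_pos; lra. }
  intros h [N1 [N2 [i [j [HN1 [_ [Hh _]]]]]]] Hhh0.
  assert (Hh0 : 0 < h).
  { rewrite Hh. apply Rdiv_lt_0_compat; [lra|]. apply lt_0_INR. exact HN1. }
  assert (Hb : Rabs (Lh (stencil P) (node_value P u h) - rhs P (stencil P) h)
    <= Lh (fun k l => Rabs (stencil P k l)) (fun _ _ => K * h ^ 8)).
  { rewrite <- (Lh_taylor P u h ha Hpde Hjump). apply Lh_diff_bound. intros k l Hk Hl.
    assert (Hmin : h <= xi P - l1 P /\ h <= l2 P - xi P /\ h <= zeta P - l3 P /\ h <= l4 P - zeta P).
    { unfold h0 in Hhh0. apply Rmin_Rgt_l in Hhh0 as [Ha Hb].
      apply Rmin_Rgt_l in Ha, Hb. lra. }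
    destruct Hmin as (M1 & M2 & M3 & M4).
    assert (Hpow : 0 <= h ^ 8) by (apply pow_le; lra).
    destruct (node_piece k l) eqn:Hp;
      [eapply Rle_trans; [apply H1; solve [assumption | lra]|]
      |eapply Rle_trans; [apply H2; solve [assumption | lra]|]
      |eapply Rle_trans; [apply H3; solve [assumption | lra]|]
      |eapply Rle_trans; [apply H4; solve [assumption | lra]|]];
      apply Rmult_le_compat_r; unfold K; lra. }
  rewrite Rabs_mult, Rabs_inv, (Rabs_pos_eq h) by lra.
  apply Rmult_le_reg_l with h; [exact Hh0|].
  rewrite <- Rmult_assoc, Rinv_r, Rmult_1_l by lra.
  (* The bound is linear in its constant entry, so K h^8 yields h times K h^7. *)
  eapply Rle_trans; [exact Hb|]. right.
  cbv [Lh Rsum map fold_right]. ring.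
Qed.
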